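(* Let $n\ge1$. For a permutation $\pi \in \mathfrak{S}_n$, we have $\operatorname{ls}_{\{1\}}(\pi) < \operatorname{is}(\pi) + 1$ if and only if the last entry of the first row of $\operatorname{evac}(Q(\pi))$ is $n$. The number of such permutations $\pi\in\mathfrak{S}_n$ is $$\sum_{\lambda \vdash n - 1} f^{\lambda + 1} f^{\lambda},$$ where $\lambda + 1 = (\lambda_1 + 1, \lambda_2, \lambda_3, \ldots)$ for any partition $\lambda=(\lambda_1,\lambda_2,\ldots)$.
   Context: $\mathfrak{S}_n$ is the set of permutations of $[n]=\{1,\dots,n\}$. For $I=\{i_1<\cdots<i_k\}\subseteq[n]$, $\pi_I=\pi(i_1)\cdots\pi(i_k)$; the descent set of a sequence $\sigma$ is $\operatorname{Des}(\sigma)=\{i : \sigma(i)>\sigma(i+1)\}$. For a set $D$ of positive integers, $\operatorname{ls}_D(\pi)=\max\{\#I : I\subseteq[n],\ \operatorname{Des}(\pi_I)=D\}$ (equal to $0$ if there is no such $I$). $\operatorname{is}(\pi)$ is the length of a longest increasing subsequence of $\pi$. $f^\lambda$ is the number of standard Young tableaux (SYT) of shape $\lambda$ (with $f^{\varnothing}=1$, and $\varnothing+1=(1)$). $Q(\pi)$ is the recording tableau of $\pi$ under the Robinson–Schensted correspondence (row insertion of $\pi(1),\dots,\pi(n)$ in order). For an SYT $Q$ with $n$ boxes, $\operatorname{evac}(Q)$ is its image under the Schützenberger involution (evacuation), an SYT of the same shape, defined by a growth diagram as follows. Define partitions $\Lambda_{i,j}$, $0\le i\le j\le n$, with $|\Lambda_{i,j}|=j-i$: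 $\Lambda_{0,j}$ is the shape formed by the boxes of $Q$ with entries at most $j$; $\Lambda_{i,i}=\varnothing$; and for $1\le i<j\le n$, $\Lambda_{i,j}$ satisfies $\Lambda_{i,j-1}\subset\Lambda_{i,j}\subset\Lambda_{i-1,j}$ and is chosen different from $\Lambda_{i-1,j-1}$ whenever possible (there are at most two partitions strictly between $\Lambda_{i,j-1}$ and $\Lambda_{i-1,j}$). Then $\operatorname{evac}(Q)$ is the SYT encoded by the chain $\varnothing=\Lambda_{n,n}\subset\Lambda_{n-1,n}\subset\cdots\subset\Lambda_{0,n}$ (the entry $i$ is in the box $\Lambda_{n-i,n}\setminus\Lambda_{n-i+1,n}$). *)

(* Defs.v *)
From mathcomp Require Import all_boot all_fingroup.
From mathcomp Require Import finmap.

Set Implicit Arguments.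
Unset Strict Implicit.
Unset Printing Implicit Defensive.

(* Letters of words and entries of tableaux are 1-based (they range over
   1, ..., n), whereas 'I_n, rows and columns are indexed from 0. A partition
   is the sequence of its nonzero parts; a tableau is the sequence of its rows,
   the first row being the longest one. *)

(* [enum I] lists the elements of [I] in increasing order, so that this is
   pi(i_1) ... pi(i_k) for I = {i_1 < ... < i_k}. *)
Definition subword n (pi : 'S_n) (I : {set 'I_n}) : seq nat :=
  [seq (val (pi i)).+1 | i <- enum I].

Definition word n (pi : 'S_n) : seq nat := subword pi [set: 'I_n].

(* The positions i in the descent set are 1-based: s(i) is [nth 0 s i.-1]. *)
Definition Des (s : seq nat) : {fset nat} :=
  [fset i in iota 1 (size s).-1 | nth 0 s i.-1 > nth 0 s i]%fset.

(* An infinite D is the descent set of no sequence, hence D is taken finite.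
   The maximum of the empty family is 0. *)
Definition ls n (D : {fset nat}) (pi : 'S_n) : nat :=
  \max_(I : {set 'I_n} | Des (subword pi I) == D) #|I|.

Definition lis n (pi : 'S_n) : nat :=
  \max_(I : {set 'I_n} | sorted ltn (subword pi I)) #|I|.

Definition is_partition (la : seq nat) : bool :=
  sorted geq la && (0 \notin la).

(* A partition of m has at most m parts, each of them at most m. *)
Definition partitions (m : nat) : seq (seq nat) :=
  [seq la <- [seq map val (b : seq 'I_m.+1) | b : {bseq m of 'I_m.+1}]
  | is_partition la && (sumn la == m)].

Lemma partitions_uniq m : uniq (partitions m).
Proof.
apply: filter_uniq; rewrite map_inj_uniq ?enum_uniq // => b1 b2 eqb.
by apply/val_inj/(inj_map val_inj).
Qed.

Lemma mem_partitions m la :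
  (la \in partitions m) = is_partition la && (sumn la == m).
Proof.
rewrite mem_filter; case: (boolP (is_partition la && _)) => //= /andP[/andP[_ nz] /eqP sm].
have szla : size la <= m.
  rewrite -sm; elim: la nz {sm} => //= x la IHla.
  rewrite inE negb_or eq_sym -lt0n => /andP[x0 /IHla le].
  by rewrite -add1n leq_add.
have bd x : x \in la -> x < m.+1.
  rewrite ltnS -sm; elim: la {nz sm szla} => //= y la IHla.
  rewrite inE => /orP[/eqP-> | /IHla]; first exact: leq_addr.
  by move/leq_trans; apply; exact: leq_addl.
have szb : size [seq inord x : 'I_m.+1 | x <- la] <= m by rewrite size_map.
apply/mapP; exists (Bseq szb); first by rewrite mem_enum.
rewrite /= -map_comp -[LHS]map_id; apply/eq_in_map => x /bd ltx /=.
by rewrite inordK.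
Qed.

Definition shape (T : seq (seq nat)) : seq nat := [seq size r | r <- T].

Definition is_SYT (n : nat) (T : seq (seq nat)) : bool :=
  [&& is_partition (shape T),
      perm_eq (flatten T) (iota 1 n),
      all (sorted ltn) T
    & sorted (fun r1 r2 => [forall c : 'I_(size r2), nth 0 r1 c < nth 0 r2 c])
        T].

(* A filling of shape la by 1, ..., |la| is determined by its reading word. *)
Definition nb_SYT (la : seq nat) : nat :=
  count (fun w => is_SYT (sumn la) (reshape la w))
    (permutations (iota 1 (sumn la))).

(* Returns the tableau resulting from the row insertion of x into P, together
   with the row of the new box. The letter x replaces the first entry of the
   row exceeding it, which is then inserted in the next row. *)
Fixpoint row_insert (P : seq (seq nat)) (x : nat) : seq (seq nat) * nat :=
  if P is r :: P' then
    let k := find (fun y => x < y) r in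
    if k == size r then (rcons r x :: P', 0)
    else let: (P'', i) := row_insert P' (nth 0 r k) in
         (set_nth 0 r k x :: P'', i.+1)
  else ([:: [:: x]], 0).

Definition RS_step (PQ : seq (seq nat) * seq (seq nat)) (tx : nat * nat) :=
  let: (P, i) := row_insert PQ.1 tx.2 in
  (P, set_nth [::] PQ.2 i (rcons (nth [::] PQ.2 i) tx.1)).

Definition RS (w : seq nat) : seq (seq nat) * seq (seq nat) :=
  foldl RS_step ([::], [::]) (zip (iota 1 (size w)) w).

Definition Qtab n (pi : 'S_n) : seq (seq nat) := (RS (word pi)).2.

Definition subshape (la mu : seq nat) : bool :=
  [forall r : 'I_(size la), nth 0 la r <= nth 0 mu r].

(* The partitions mu such that be < mu < ga with |mu| = |be| + 1. *)
Definition between (be ga : seq nat) : seq (seq nat) :=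
  [seq mu <- [seq incr_nth be r | r <- iota 0 (size be).+1]
  | is_partition mu && subshape mu ga].

(* A member of [between be ga] different from al if there is one. *)
Definition local_rule (al be ga : seq nat) : seq nat :=
  let cands := between be ga in
  head (head [::] cands) [seq mu <- cands | mu != al].

Definition shape_upto (Q : seq (seq nat)) (j : nat) : seq nat :=
  [seq k <- [seq count (fun e => e <= j) r | r <- Q] | 0 < k].

(* [growth Q i j] is Lambda_(i,j); it is meaningless (empty) for j < i. *)
Fixpoint growth (Q : seq (seq nat)) (i : nat) : nat -> seq nat :=
  if i is i'.+1 then
    fix row (j : nat) : seq nat :=
      if j is j'.+1 then
        if j <= i then [::]
        else local_rule (growth Q i' j') (row j') (growth Q i' j)
      else [::]
  else shape_upto Q.

(* The tableau encoded by a chain of partitions sh 0, ..., sh n: the entry k is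
   in the row where sh k has one more box than sh k.-1. *)
Definition chain_tableau (n : nat) (sh : nat -> seq nat) : seq (seq nat) :=
  [seq [seq k <- iota 1 n | nth 0 (sh k.-1) r < nth 0 (sh k) r]
  | r <- iota 0 (size (sh n))].

Definition evac (Q : seq (seq nat)) : seq (seq nat) :=
  let n := sumn (shape Q) in
  chain_tableau n (fun k => growth Q (n - k) n).

(* The partition la + 1; in particular the empty one is sent to (1). *)
Definition add1 (la : seq nat) : seq nat := incr_nth la 0.

(* Main.v *)
Require Import Defs.
From mathcomp Require Import all_boot all_fingroup.
From mathcomp Require Import finmap.
From mathcomp Require Import zify.

Set Implicit Arguments.
Unset Strict Implicit.
Unset Printing Implicit Defensive.

(** Write w = x u for the word of pi, x being its first letter, and P(v) for the
insertion tableau of a word v.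

Reduction to first rows. A sequence with descent set {1} is an increasing
sequence preceded by a letter larger than its first one, so that ls_{1} is at
most is + 1. If u has an increasing subsequence of length is(w), then x is larger
than its first letter, since otherwise x would prolong it; prepending x then
gives a sequence counted by ls_{1}. Hence ls_{1} < is + 1 holds if and only if
is(u) < is(w) ([ls1_row1]). By Schensted's theorem ([row1_attained],
[row1_max]) these numbers are the lengths of the first rows of P(u) and P(w).

Evacuation. The last entry of the first row of evac(Q) is n if and only if
Lambda_(1,n) and Lambda_(0,n) have different first rows ([evac_last]). Since
Lambda_(0,j) is the shape of P(w_1 ... w_j), it remains to see that Lambda_(1,j)
is the shape of P(w_2 ... w_j) ([growth1_RS]), that is, that the shapes of P(v),
P(xv), P(vy) and P(xvy) obey the local rule ([local_rule_word]). This is proved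
by letting the insertion of a word run simultaneously in S = P(v) and
R = P(xv). At any time, the rows of R arise from those of S by trading, in each
row r, a letter c_r for a letter c_(r+1) <= c_r, where c_0 is infinite; these
are the letters moved by the column insertion of x into S ([coupled]). When y is
inserted into both tableaux, either the same letter enters row r of both, or c_r
enters the row of R, while the letter that enters the row of S becomes the new
c_r ([coupled_row], [coupled_insert]). If the boxes added to S by x and by y
coincide, then y moves through S and R alike above that box, and the box that it
adds to R turns out to be adjacent to it ([second_box_adjacent]); hence the local
rule has no choice. If they differ, its choice is the shape of P(vy).

Counting. Reversing and complementing words turns is(u) < is(w) into the
condition that deleting the last letter shortens the longest increasing
subsequences ([card_row1_behead]), which means that the insertion of the last
letter adds a box to the first row. Since row insertion can be undone
([row_insert_inj], [row_insert_surj]), sending w to P(w) and to the recording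
tableau of w without its last letter is a bijection from these words to the
pairs of standard Young tableaux of shapes la + 1 and la
([count_last_in_row1]). *)

(** * Counting the small entries of a row *)

(** Rows are handled through these counting functions: inserting a letter adds
the indicator function of an interval, so that the comparison of two insertions
becomes linear arithmetic. *)
Definition below (s : seq nat) (v : nat) := count (fun e => e < v) s.
Arguments below : simpl never.

Lemma below_cons e s v : below (e :: s) v = (e < v) + below s v.
Proof. by []. Qed.

Lemma below_mono s v w : v <= w -> below s v <= below s w.
Proof. by move=> vw; apply: sub_count => e /= ev; apply: leq_trans vw. Qed.

Lemma belowS s v : uniq s -> below s v.+1 = below s v + (v \in s).
Proof.
rewrite /below; elim: s => //= e s IHs /andP[es us].
rewrite (IHs us) inE; case: (ltngtP e v) es => [||->] /=; lia.
Qed.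

Lemma below_size M s : all (fun e => e < M) s -> below s M = size s.
Proof. by rewrite all_count => /eqP. Qed.

Lemma below_le_size s v : below s v <= size s.
Proof. exact: count_size. Qed.

Lemma sorted_ltn_below0 e s v : sorted ltn (e :: s) -> v <= e ->
  below (e :: s) v = 0.
Proof.
move=> ps ve; apply/eqP; rewrite /below -leqn0 leqNgt -has_count.
apply/hasPn => x xs; rewrite -leqNgt (leq_trans ve) //.
move: xs; rewrite inE => /predU1P[->//|xs]; apply: ltnW.
by move: ps; rewrite /= (path_sortedE ltn_trans) => /andP[/allP/(_ _ xs)].
Qed.

Lemma sorted_below_nth s v c : sorted ltn s ->
  (c < below s v) = (c < size s) && (nth 0 s c < v).
Proof.
elim: s c => [|e s IHs] c ps; first by rewrite /below.
rewrite below_cons; case: (ltnP e v) => ev; last first.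
  have := sorted_ltn_below0 ps ev; rewrite below_cons ltnNge ev => ->; apply/esym/negbTE.
  rewrite negb_and -!leqNgt; case: c => [|c] /=; first by rewrite ev.
  case: (leqP (size s) c) => cs; first by rewrite ltnS cs.
  rewrite (leq_trans ev) ?orbT //; apply: ltnW.
  by move: ps; rewrite /= (path_sortedE ltn_trans) => /andP[/allP/(_ _ (mem_nth 0 cs))].
by case: c => [|c] /=; rewrite add1n ?ltnS ?IHs ?(path_sorted ps).
Qed.

Lemma sorted_below_inj s1 s2 : sorted ltn s1 -> sorted ltn s2 ->
  below s1 =1 below s2 -> s1 = s2.
Proof.
move=> so1 so2 eq12; apply: (irr_sorted_eq ltn_trans ltnn) => // v.
have u1 := sorted_uniq ltn_trans ltnn so1; have u2 := sorted_uniq ltn_trans ltnn so2.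
by have := eq12 v.+1; rewrite !belowS // eq12 => /addnI; do 2!case: (_ \in _).
Qed.

(** * Insertion into one row *)

(** [M] plays the role of infinity: it exceeds all entries, it is what is bumped
by a letter appended to the row, and inserting it changes nothing. *)
Definition bumped M (s : seq nat) y := nth M s (find (fun e => y < e) s).
Definition ins M (s : seq nat) y :=
  if y < M then set_nth 0 s (find (fun e => y < e) s) y else s.

Lemma bumped_cons M e s y :
  bumped M (e :: s) y = if y < e then e else bumped M s y.
Proof. by rewrite /bumped /=; case: ifP. Qed.

Lemma ins_cons M e s y : y < M ->
  ins M (e :: s) y = if y < e then y :: s else e :: ins M s y.
Proof. by rewrite /ins /= => ->; case: ifP. Qed.

Lemma bumped_ge M s y : all (fun e => e < M) s -> M <= y -> bumped M s y = M.
Proof.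
elim: s => //= e s IHs /andP[eM sM] My; rewrite bumped_cons IHs //.
by case: ifP => //; lia.
Qed.

Lemma bumped_le M s y : all (fun e => e < M) s -> bumped M s y <= M.
Proof.
elim: s => [|e t IH] /=; first by rewrite /bumped.
by case/andP=> eM /IH le; rewrite bumped_cons; case: ifP => _ //; exact: ltnW.
Qed.

Lemma bumped_gt M s y : y < M -> y < bumped M s y.
Proof.
by move=> yM; elim: s => [|e t IH]; rewrite ?bumped_cons //; case: ifP.
Qed.

Lemma bumped_mem M s y : bumped M s y < M -> bumped M s y \in s.
Proof.
elim: s => [|e t IH]; first by rewrite /bumped /= ltnn.
by rewrite bumped_cons inE; case: ifP => [|_ /IH->]; rewrite ?eqxx ?orbT.
Qed.

Lemma below_bumped M s y : sorted ltn s -> y < M ->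
  below s (bumped M s y) = below s y.+1.
Proof.
move=> so yM; elim: s so => //= e t IH pt; rewrite bumped_cons.
case: (ltnP y e) => ye; first by rewrite !sorted_ltn_below0.
have := bumped_gt t yM; rewrite !below_cons IH ?(path_sorted pt) //.
by lia.
Qed.

Lemma below_ins M s y v : sorted ltn s -> all (fun e => e < M) s ->
  y < M -> v <= M -> below (ins M s y) v = below s v + (y < v <= bumped M s y).
Proof.
move=> so sM yM vM; elim: s so sM => [|e t IH] /=.
  by move=> _ _; rewrite /ins /= yM /below /bumped /=; lia.
move=> pt /andP[eM tM]; rewrite ins_cons // bumped_cons.
case: (ltnP y e) => ye; first by rewrite /below /=; lia.
by rewrite !below_cons IH ?(path_sorted pt) //; lia.
Qed.

Lemma ins_sorted M s y : sorted ltn s -> y \notin s -> sorted ltn (ins M s y).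
Proof.
case: (ltnP y M) => [yM|My]; last by rewrite /ins ltnNge My.
elim: s => [|e t IH] /=; first by rewrite /ins yM.
rewrite ins_cons // inE negb_or neq_ltn => pt /andP[yne yt].
have st := path_sorted pt; have := IH st yt.
move: pt; rewrite (path_sortedE ltn_trans) => /andP[/allP et _].
case: ltnP yne => [ye _|_ /= ey] it; rewrite /= (path_sortedE ltn_trans) ?st ?it andbT.
  by apply/allP => x /et /=; apply: ltn_trans.
apply/allP => x; rewrite /ins yM => xi.
have : x \in y :: t.
  elim: (t) {et st it IH yt} xi => //= f u IHu.
  case: ifP => _; rewrite !inE; do ?[case: eqP => //= _] => /IHu;
    by rewrite inE => /orP[->|->]; rewrite ?orbT.
by rewrite inE => /predU1P[->//|/et].
Qed.

(** What the insertion of [y] into a row with distinct entries, which bumps [o],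
does to the counting function [N] of the row. *)
Record ins_spec M (N : nat -> nat) y (N' : nat -> nat) o : Prop := InsSpec {
  ins_mono : forall v w, v <= w -> N v <= N w;
  ins_lip : forall v, N v.+1 <= (N v).+1;
  ins_below : forall v, v <= M -> N' v = N v + (y < v <= o);
  ins_bumped : y < M ->
    [/\ y < o <= M, N o = N y.+1, N y.+1 = N y & o < M -> N o.+1 = (N o).+1];
  ins_skip : M <= y -> o = M }.

Lemma insP M s y : sorted ltn s -> all (fun e => e < M) s -> y <= M ->
  y \notin s -> ins_spec M (below s) y (below (ins M s y)) (bumped M s y).
Proof.
move=> so sM yM ys; have us := sorted_uniq ltn_trans ltnn so.
split; first exact: below_mono.
- by move=> v; rewrite belowS //; case: (v \in s); rewrite ?addn1 ?addn0.
- move=> v vM; case: (ltnP y M) => ltyM; first exact: below_ins.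
  by rewrite /ins ltnNge ltyM /=; lia.
- move=> ltyM; split; rewrite ?below_bumped ?bumped_gt ?bumped_le //.
    by rewrite belowS // (negbTE ys) addn0.
  by move=> /bumped_mem bs; rewrite belowS // bs below_bumped // addn1.
- by move=> My; apply: bumped_ge.
Qed.

(** The bumped letter can be read off the counting function, which is the way it
is found in a row known only by comparison with another one. *)
Lemma ins_spec_uniq M N y N' o o2 : ins_spec M N y N' o -> y < M -> y < o2 <= M ->
  N o2 = N y.+1 -> (o2 < M -> N o2.+1 = (N o2).+1) -> o = o2.
Proof.
move=> st yM o2P e2 l2; have [o1P e1 _ l1] := ins_bumped st yM.
case: (ltngtP o o2) => // lt.
  by have := ins_mono st lt; rewrite l1; lia.
by have := ins_mono st lt; rewrite l2; lia.
Qed.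

(** * Simultaneous insertion into two rows *)

(** [U] and [UR] are corresponding rows of two tableaux S and R, where [UR] is
[U] with [p] traded for [a]: the letter [p] is carried over the edge above the
row, and [a] over the edge below. One of two events happens on the edge above.
Either [y] enters both rows and [p] stays, or [p] enters [UR] and [y] is carried
in its place. The lemma shows that one of the same two events happens on the edge
below, and that the rows remain related. If [y < p] in the first event, the first
inequality provides an entry of [U] beyond [y] and up to [p], so that [y] bumps at
most [p], and the second excludes that it bumps [p] from [U] when [a < y]. The equation in
the second event says that [U] has no entry strictly between [p] and [y]. All
this comes from the column conditions of S and R. *)
Lemma coupled_row M U U' UR UR' y o yR oR p p' a :
  ins_spec M U y U' o -> ins_spec M UR yR UR' oR -> y <= M -> a <= p <= M ->
  (forall v, v <= M -> UR v = U v + (a < v <= p)) ->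
  [/\ yR = y, p' = p & y < p < M -> U y.+1 < U p.+1 /\ UR y.+1 < U p.+1] \/
  [/\ yR = p, p' = y, p < y & U y = U p.+1] ->
  exists a', [/\ a' <= p',
    forall v, v <= M -> UR' v = U' v + (a' < v <= p') &
    [/\ oR = o, a' = a & ~~ (y < a < o)] \/
    [/\ oR = a, a' = o, a < o & [/\ U o = U a, yR = y & y < a]]].
Proof.
move=> st stR yM /andP[ap pM] UR_E edge.
have mono := ins_mono st.
have new := ins_below st; have newR := ins_below stR.
case: edge => [[eqyR eqp py]|[eqyR eqp py Upy]]; subst yR p'; last first.
  (* There is nothing in [U] between [p] and [y], so that [p] bumps from [UR]
     what [y] bumps from [U]. *)
  have UR_p : UR p.+1 = U p.+1 by rewrite UR_E; lia.
  have [/andP[yo oM] Uo] : y <= o <= M /\ U o = U p.+1.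
    have [yltM|yge] := ltnP y M; first by have [] := ins_bumped st yltM; lia.
    have eyM : y = M by [lia]; subst y; have -> := ins_skip st yge.
    by rewrite Upy; lia.
  have eqo : oR = o.
    apply: (ins_spec_uniq stR); [lia|lia|by rewrite UR_p UR_E; lia|].
    move=> oltM; rewrite !UR_E; try lia.
    by have yltM : y < M by [lia]; have [_ _ _] := ins_bumped st yltM; lia.
  exists a; split; [lia | | left; split=> //; lia].
  move=> v vM; rewrite new // newR // UR_E // eqo.
  have [yltM|yge] := ltnP y M; last by have := ins_skip st yge; lia.
  by have [/andP[lt_yo _] _ _ _] := ins_bumped st yltM; lia.
have [yltM|yge] := ltnP y M; last first.
  have oM := ins_skip st yge; have oRM := ins_skip stR yge.
  exists a; split; [lia| |left; split; lia].
  by move=> v vM; rewrite new // newR // UR_E //; lia.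
have [/andP[yo oM] Uo Uy oU] := ins_bumped st yltM.
have [_ _ URy _] := ins_bumped stR yltM.
have URy1 : UR y.+1 = U y.+1 + (a < y.+1 <= p) by apply: UR_E.
have URy0 : UR y = U y + (a < y <= p) by apply: UR_E; lia.
have no_py : ~ (y < p < M /\ p < o).
  by move=> [ypM po]; have := mono p.+1 o po; have [] := py ypM; lia.
have passes : oR = o -> ~~ (y < a < o) -> exists a', [/\ a' <= p,
    forall v, v <= M -> UR' v = U' v + (a' < v <= p) &
    [/\ oR = o, a' = a & ~~ (y < a < o)] \/
    [/\ oR = a, a' = o, a < o & [/\ U o = U a, y = y & y < a]]].
  move=> eqo nya; exists a; split; [lia| |by left].
  by move=> v vM; rewrite new // newR // UR_E // eqo; lia.
have [/eqP eqa|ltap] := boolP (a == p).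
  have UR_U v : v <= M -> UR v = U v by move=> vM; rewrite UR_E //; lia.
  apply: passes; last by lia.
  apply: (ins_spec_uniq stR); [lia|lia|by rewrite !UR_U; lia|].
  by move=> oltM; rewrite !UR_U //; auto.
have {}ltap : a < p by lia.
have [ya|ay] : y < a \/ a < y by lia.
  have [oa|ao] : o <= a \/ a < o by lia.
    apply: passes; last by lia.
    apply: (ins_spec_uniq stR); [lia|lia|by rewrite !UR_E; lia|].
    move=> oltM; have := oU oltM; have := ins_lip stR o.
    by rewrite !UR_E; lia.
  (* The additional letter [a] of [UR] lies between [y] and [o], hence it is
     bumped instead of [o]. *)
  have op : o <= p by lia.
  have Ua : U o = U a by have := mono a o; have := mono y.+1 a; lia.
  have oRa : oR = a.
    apply: (ins_spec_uniq stR); [lia|lia|by rewrite !UR_E; lia|].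
    move=> aM; rewrite !UR_E //; last by lia.
    by have := mono a a.+1; have := mono a.+1 o; lia.
  exists o; split; [lia| |by right].
  by move=> v vM; rewrite new // newR // UR_E // oRa; lia.
(* As [a] is less than [y], it is counted by [UR y.+1]. *)
have no_op : ~ (p < M /\ o = p).
  move=> [ltpM eop]; have := oU; have ypM : y < p < M by lia.
  by have [] := py ypM; rewrite -eop; lia.
apply: passes; last by lia.
apply: (ins_spec_uniq stR); [lia|lia|by rewrite !UR_E; lia|].
by move=> oltM; rewrite !UR_E; have := oU oltM; lia.
Qed.

(** * Tableaux under row insertion *)

(** The letter that enters row [r] of [T] when [y] is inserted; it is infinite
below the row of the new box. *)
Fixpoint entering M (T : seq (seq nat)) (y r : nat) : nat :=
  if r is r'.+1 then bumped M (nth [::] T r') (entering M T y r') else y.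

Lemma entering_cons M s T y r : entering M (s :: T) y r.+1 = entering M T (bumped M s y) r.
Proof. by elim: r => //= r ->. Qed.

Lemma all_row (P : pred nat) T r : all P (flatten T) -> all P (nth [::] T r).
Proof.
elim: T r => [|s T IH] [|r] //=; rewrite all_cat => /andP[] // _; exact: IH.
Qed.

Lemma entering_ge M T y r : all (fun e => e < M) (flatten T) -> M <= y -> 0 < r ->
  entering M T y r = M.
Proof.
move=> TM My; case: r => // r _; elim: r => [|r IH] /=.
  exact/bumped_ge/My/all_row.
by apply: bumped_ge; [exact: all_row | rewrite -[X in M <= X]/(entering M T y r.+1) IH].
Qed.

Lemma entering_le M T y r : all (fun e => e < M) (flatten T) -> y <= M ->
  entering M T y r <= M.
Proof. by move=> TM yM; case: r => //= r; apply/bumped_le/all_row. Qed.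

Lemma row_insert_cons M s T x : all (fun e => e < M) s -> x < M ->
  row_insert (s :: T) x =
  if bumped M s x == M then (ins M s x :: T, 0)
  else ((ins M s x) :: (row_insert T (bumped M s x)).1,
        (row_insert T (bumped M s x)).2.+1).
Proof.
move=> sM xM /=; rewrite /ins xM.
have -> : (bumped M s x == M) = (find (fun y => x < y) s == size s).
  rewrite /bumped; case: (ltnP (find (fun y => x < y) s) (size s)) => fs.
    by rewrite !ltn_eqF //; apply: (allP sM); apply: mem_nth.
  by rewrite nth_default // eqxx eqn_leq fs find_size.
case: eqP => [->|/eqP fs].
  by congr (_ :: _, _); elim: s {sM} => //= e s ->.
rewrite (_ : nth 0 s _ = bumped M s x); first by case: row_insert.
by apply: set_nth_default; rewrite ltn_neqAle fs find_size.
Qed.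

Lemma row_insert_row M T x r : all (fun e => e < M) (flatten T) -> x < M ->
  nth [::] (row_insert T x).1 r = ins M (nth [::] T r) (entering M T x r).
Proof.
elim: T x r => [|s T IH] x r.
  case: r => [|r] _ xM; first by rewrite /ins /= xM.
  by rewrite /= /ins !nth_nil /bumped /= ltnn.
rewrite [flatten _]/= all_cat => /andP[sM TM] xM; rewrite (row_insert_cons _ sM xM).
case: eqP => [bM|/eqP bM]; case: r => [|r] //=; rewrite -/(entering _ _ _ r.+1) entering_cons.
  case: r => [|r]; rewrite /ins ?bM /= ?ltnn //.
  by rewrite -/(entering M T M r.+1) entering_ge // ltnn.
by rewrite IH // ltn_neqAle bM bumped_le.
Qed.

Lemma row_insert_idx M T x r : all (fun e => e < M) (flatten T) -> x < M ->
  (r <= (row_insert T x).2) = (entering M T x r < M).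
Proof.
elim: T x r => [|s T IH] x r.
  by case: r => [|r] _ xM //=; rewrite nth_nil /bumped /= ltnn.
rewrite [flatten _]/= all_cat => /andP[sM TM] xM; rewrite (row_insert_cons _ sM xM).
case: eqP => [bM|/eqP bM]; case: r => [|r] //=; rewrite -/(entering _ _ _ r.+1) entering_cons.
  case: r => [|r]; rewrite ?bM ?ltnn //.
  by rewrite entering_ge // ltnn.
by rewrite ltnS IH // ltn_neqAle bM bumped_le.
Qed.

Lemma perm_swap (e x : nat) s : perm_eq [:: e, x & s] [:: x, e & s].
Proof. exact: permEl (perm_catCA [:: e] [:: x] s). Qed.

Lemma ins_perm_inf M s x : x < M -> bumped M s x = M -> all (fun e => e < M) s ->
  perm_eq (ins M s x) (x :: s).
Proof.
move=> xM; elim: s => [|e s IH] /=; first by rewrite /ins xM.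
rewrite bumped_cons ins_cons //; case: ifP => _ bM /andP[eM sM].
  by rewrite bM ltnn in eM.
by apply: (perm_trans _ (perm_swap e x s)); rewrite perm_cons IH.
Qed.

Lemma ins_perm_fin M s x : x < M -> bumped M s x < M ->
  perm_eq (bumped M s x :: ins M s x) (x :: s).
Proof.
move=> xM; elim: s => [|e s IH] /=; first by rewrite /bumped /= ltnn.
rewrite bumped_cons ins_cons //; case: ifP => _ bM.
  exact: perm_swap.
apply: (perm_trans (perm_swap _ _ _)); apply: (perm_trans _ (perm_swap e x s)).
by rewrite perm_cons; exact: IH.
Qed.

Lemma row_insert_perm M T x : all (fun e => e < M) (flatten T) -> x < M ->
  perm_eq (flatten (row_insert T x).1) (x :: flatten T).
Proof.
elim: T x => [|s T IH] x //.
rewrite [flatten _]/= all_cat => /andP[sM TM] xM; rewrite (row_insert_cons _ sM xM).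
case: eqP => [bM|/eqP bM] /=.
  by rewrite -cat_cons perm_cat2r ins_perm_inf.
have {}bM : bumped M s x < M by rewrite ltn_neqAle bM bumped_le.
apply: (perm_trans (y := ins M s x ++ bumped M s x :: flatten T)).
  by rewrite perm_cat2l IH.
apply: (perm_trans (permEl (perm_catCA _ [:: bumped M s x] _))).
exact: perm_cat (ins_perm_fin xM bM) (perm_refl _).
Qed.

Lemma row_insert_shape T x :
  shape (row_insert T x).1 = incr_nth (shape T) (row_insert T x).2.
Proof.
elim: T x => [|s T IH] x //=; case: eqP => [_|/eqP fs] /=.
  by rewrite size_rcons.
have := IH (nth 0 s (find (fun y => x < y) s)); case: row_insert => P i /= ->.
by rewrite size_set_nth (maxn_idPr _) // ltn_neqAle fs find_size.
Qed.

Lemma row_insert_idx_le T x : (row_insert T x).2 <= size T.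
Proof.
elim: T x => [|s T IH] x //=; case: eqP => [_|/eqP fs] //=.
by have := IH (nth 0 s (find (fun y => x < y) s)); case: row_insert.
Qed.

Lemma row_insert_nonnil T x : [::] \notin T -> [::] \notin (row_insert T x).1.
Proof.
elim: T x => [|s T IH] x //=; rewrite inE negb_or => /andP[s0 T0].
case: eqP => [_|/eqP fs]; first by rewrite inE negb_or T0 andbT; case: (s).
have := IH (nth 0 s (find (fun y => x < y) s)) T0; case: row_insert => P i /= P0.
rewrite inE negb_or P0 andbT eq_sym -size_eq0 size_set_nth.
by rewrite gtn_eqF // leq_max.
Qed.

Lemma entering_mem M T x r : all (fun e => e < M) (flatten T) ->
  entering M T x r < M -> entering M T x r \in x :: flatten (take r T).
Proof.
elim: T x r => [|s T IH] x [|r]; rewrite ?mem_head //.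
  by rewrite /= nth_nil /bumped /= ltnn.
rewrite entering_cons /= all_cat => /andP[sM TM] lt; have := IH _ _ TM lt.
have := lt; rewrite !inE mem_cat.
case: (ltnP (bumped M s x) M) => [/bumped_mem bs|bM].
  by move=> _ /predU1P[->|->]; rewrite ?bs ?orbT.
case: r lt => [|r] lt; first by rewrite /= ltnNge bM.
by rewrite entering_ge ?ltnn.
Qed.

Lemma entering_notin M T x r : all (fun e => e < M) (flatten T) -> x <= M ->
  uniq (x :: flatten T) -> entering M T x r \notin nth [::] T r.
Proof.
move=> TM xM; have := entering_le r TM xM; rewrite leq_eqVlt => /predU1P[->|lt] un.
  by apply/negP => /(allP (all_row r TM)); rewrite ltnn.
have := entering_mem TM lt; move: un; rewrite -{1}(cat_take_drop r T) flatten_cat.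
case: (ltnP r (size T)) => rT; last by rewrite [nth _ _ _]nth_default.
rewrite (drop_nth [::]) // [flatten (_ :: _)]/= -cat_cons cat_uniq => /and3P[_ /hasPn dj _] it.
apply/negP => ir; apply: (negP (dj (entering M T x r) _)); last exact: it.
by rewrite mem_cat ir.
Qed.

Lemma bound_exists (s : seq nat) : exists M, all (fun e => e < M) s.
Proof.
exists (\max_(e <- s) e).+1; apply/allP => e es; rewrite ltnS.
exact: leq_bigmax_seq.
Qed.

Lemma bounded_le M M' (s : seq nat) : M <= M' ->
  all (fun e => e < M) s -> all (fun e => e < M') s.
Proof. by move=> MM'; apply: sub_all => e /= eM; apply: leq_trans MM'. Qed.

(** No condition is put on the set of entries. The column condition is stated by
counting, so as to be compared with [ins_spec]: the entries at most [v] of a row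
are no more than the entries less than [v] of the row above. *)
Record tableau (T : seq (seq nat)) : Prop := Tableau {
  tab_nonnil : [::] \notin T;
  tab_uniq : uniq (flatten T);
  tab_sorted : forall r, sorted ltn (nth [::] T r);
  tab_col : forall r v, below (nth [::] T r.+1) v.+1 <= below (nth [::] T r) v }.

Lemma row_insertP M T x r : (forall r, sorted ltn (nth [::] T r)) ->
  all (fun e => e < M) (flatten T) -> x < M -> uniq (x :: flatten T) ->
  ins_spec M (below (nth [::] T r)) (entering M T x r)
    (below (nth [::] (row_insert T x).1 r)) (entering M T x r.+1).
Proof.
move=> so TM xM un; rewrite (row_insert_row r TM xM); apply: insP => //.
- exact: all_row.
- exact/entering_le/ltnW.
- by apply: entering_notin => //; apply: ltnW.
Qed.

(** Let [o] enter row [r.+1] and bump [o2]. The count of row [r.+1] grows between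
[o] and [o2] only, where it was constant, so that the old column condition at [o]
suffices: beyond [o] the count of row [r] is larger by the entry [o] itself. *)
Lemma row_insert_tableau T x : tableau T -> x \notin flatten T ->
  tableau (row_insert T x).1.
Proof.
move=> tT xT; have [T0 uT so col] := tT.
have un : uniq (x :: flatten T) by rewrite /= xT.
have [M0 TM0] := bound_exists (x :: flatten T).
split; first exact: row_insert_nonnil.
- have /andP[xM TM] := TM0.
  by rewrite (perm_uniq (row_insert_perm TM xM)).
- have /andP[xM TM] := TM0; move=> r.
  rewrite (row_insert_row r TM xM); apply: ins_sorted => //; apply: entering_notin => //.
  exact: ltnW.
move=> r v.
have [M [xM TM vM]] :
    exists M, [/\ x < M, all (fun e => e < M) (flatten T) & v < M].
  exists (maxn M0 v.+1); have /andP[xM TM] := bounded_le (leq_maxl M0 v.+1) TM0.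
  by rewrite leq_maxr.
have st k := row_insertP k so TM xM un.
rewrite (ins_below (st r)) ?(ins_below (st r.+1)) //; last exact: ltnW.
have lip := ins_lip (st r); have mono := ins_mono (st r.+1); have mono0 := ins_mono (st r).
set o := entering M T x r.+1; set y := entering M T x r; set o2 := entering M T x r.+2.
have [oM|Mo] := ltnP o M; last by have := col r v; lia.
have yM : y < M.
  rewrite -(row_insert_idx _ TM xM) (leq_trans _ (_ : r.+1 <= _)) //.
  by rewrite (row_insert_idx _ TM xM).
have [yo eo _ oS] := ins_bumped (st r) yM; have [oo2 eo2 _ _] := ins_bumped (st r.+1) oM.
have := col r v; have [vo|vo] := boolP (o < v.+1 <= o2); last by lia.
have := col r o; have := mono v.+1 o2; have := oS oM; have := mono0 o.+1 v.
rewrite -/o -/o2 -/y in eo2 eo *.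
lia.
Qed.

Lemma tableau_nil : tableau [::].
Proof. by split=> // r; rewrite ?nth_nil // => v; rewrite nth_nil. Qed.

Lemma size_row_nonincr T r : tableau T -> size (nth [::] T r.+1) <= size (nth [::] T r).
Proof.
case=> _ _ _ col; have [M TM] := bound_exists (flatten T).
have := col r M; rewrite (below_size (all_row r TM)) (@below_size M.+1) //.
exact: bounded_le (leqnSn M) (all_row _ TM).
Qed.

Lemma nth_shape (T : seq (seq nat)) r : nth 0 (shape T) r = size (nth [::] T r).
Proof.
by case: (ltnP r (size T)) => rT; [rewrite (nth_map [::]) | rewrite !nth_default ?size_map].
Qed.

Lemma tableau_shape T : tableau T -> is_partition (shape T).
Proof.
move=> tT; apply/andP; split; last first.
  apply/mapP => -[s sT /esym/eqP]; rewrite size_eq0 => /eqP s0.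
  by have := tab_nonnil tT; rewrite -s0 sT.
apply/(sortedP 0) => i _; rewrite !nth_shape; exact: size_row_nonincr.
Qed.

(** * Coupled insertion into two tableaux *)

(** Relation between the insertion tableaux [S] of a word and [R] of the same word
preceded by a letter. The [c r] are the letters moved by the column insertion of
that letter into [S], read from the bottom upwards and infinite above the new
box. The last condition is what makes it a column insertion: when [c r.+1] leaves
row [r.+1], it goes to the next column of row [r]. *)
Record coupled M (S R : seq (seq nat)) (c : nat -> nat) : Prop := Coupled {
  cpl_top : c 0 = M;
  cpl_dec : forall r, c r.+1 <= c r;
  cpl_row : forall r v, v <= M ->
    below (nth [::] R r) v = below (nth [::] S r) v + (c r.+1 < v <= c r);
  cpl_tight : forall r, c r.+1 < M ->
    below (nth [::] S r) (c r.+1) = below (nth [::] S r.+1) (c r.+1).+1 }.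

Lemma cpl_le M S R c r : coupled M S R c -> c r <= M.
Proof.
case=> c0 dec _ _; elim: r => [|r IH]; first by rewrite c0.
exact: leq_trans (dec r) IH.
Qed.

(** The two events that may happen on the edge below row [r] when [y] is inserted
into both tableaux; cf. [coupled_row]. *)
Definition pass_edge M S R c y r :=
  entering M R y r.+1 = entering M S y r.+1 /\
  ~~ (entering M S y r < c r.+1 < entering M S y r.+1).

Definition swap_edge M S R (c : nat -> nat) y r :=
  [/\ entering M R y r.+1 = c r.+1, c r.+1 < entering M S y r.+1,
      entering M R y r = entering M S y r,
      below (nth [::] S r) (entering M S y r.+1) = below (nth [::] S r) (c r.+1)
    & entering M S y r < c r.+1].

Definition next_carrier M S R (c : nat -> nat) y r :=
  if entering M R y r == entering M S y r then c r else entering M S y r.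

(** The rows are treated from the top downwards with [coupled_row]. Its
hypotheses follow from the column conditions, since [cpl_tight] turns the count
of a row into that of the row above. Of the new equations [cpl_tight], one
inequality is the column condition of the new tableau, the other results from
the event on the edge. *)
Lemma coupled_insert M S R c y : tableau S -> tableau R ->
  all (fun e => e < M) (flatten S) -> all (fun e => e < M) (flatten R) ->
  y < M -> y \notin flatten S -> y \notin flatten R -> coupled M S R c ->
  coupled M (row_insert S y).1 (row_insert R y).1 (next_carrier M S R c y) /\
  forall r, pass_edge M S R c y r \/ swap_edge M S R c y r.
Proof.
move=> tS tR SM RM yM yS yR cpl; have [c0 dec rows tight] := cpl.
have cM r := cpl_le r cpl.
have usS : uniq (y :: flatten S) by rewrite /= yS (tab_uniq tS).
have usR : uniq (y :: flatten R) by rewrite /= yR (tab_uniq tR).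
have stS r := row_insertP r (tab_sorted tS) SM yM usS.
have stR r := row_insertP r (tab_sorted tR) RM yM usR.
have colS := tab_col tS; have colR := tab_col tR.
have inpM r : entering M S y r <= M by apply: entering_le => //; apply: ltnW.
set c' := next_carrier M S R c y.
pose done_row r := [/\ c' r.+1 <= c' r,
    forall v, v <= M -> below (nth [::] (row_insert R y).1 r) v =
      below (nth [::] (row_insert S y).1 r) v + (c' r.+1 < v <= c' r)
    & pass_edge M S R c y r \/ swap_edge M S R c y r].
have main r :
    [/\ entering M R y r = entering M S y r, c' r = c r
      & entering M S y r < c r < M ->
      below (nth [::] S r) (entering M S y r).+1 < below (nth [::] S r) (c r).+1 /\
      below (nth [::] R r) (entering M S y r).+1 < below (nth [::] S r) (c r).+1] \/
      [/\ entering M R y r = c r, c' r = entering M S y r, c r < entering M S y r &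
       below (nth [::] S r) (entering M S y r) = below (nth [::] S r) (c r).+1] ->
  done_row r.
    move=> edge; have cr : c r.+1 <= c r <= M by rewrite dec cM.
    have [a' [a'c' rows' out]] := coupled_row (stS r) (stR r) (inpM r) cr (rows r) edge.
    have ea : c' r.+1 = a'.
      case: out => [[e1 -> _]|[e1 -> lt _]]; rewrite /c' /next_carrier e1 ?eqxx //.
      by rewrite ltn_eqF.
    rewrite /done_row ea; split=> //.
    by case: out => [[e1 _ ?]|[e1 _ lt [? ? ?]]]; [left|right].
have key r : done_row r.
  elim: r => [|r [_ _ IH]]; apply: main.
    by left; rewrite /= /c' /next_carrier /= eqxx c0; split=> //; lia.
  case: IH => [[e1 nbet]|[e1 lt e0 eb lt0]].
    left; rewrite /c' /next_carrier e1 eqxx; split=> // /andP[yp pM].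
    have ltrM : entering M S y r < M.
      rewrite ltnNge; apply/negP => Mr; have := ins_skip (stS r) Mr; lia.
    have [_ _ _ inS] := ins_bumped (stS r) ltrM; have {}inS := inS (ltn_trans yp pM).
    have mono := ins_mono (stS r) yp.
    have := colS r (entering M S y r.+1); have := colR r (entering M S y r.+1).
    rewrite (rows r) // -(tight r pM); lia.
  right; rewrite /c' /next_carrier e1 ltn_eqF //; split=> //.
  have mono := ins_mono (stS r.+1) lt; have pM : c r.+1 < M by apply: leq_trans lt _.
  have := colS r (entering M S y r.+1).-1; have := tight r pM.
  have := ins_mono (stS r) (leq_pred (entering M S y r.+1)).
  rewrite (ltn_predK lt); lia.
split=> [|r]; last by have [] := key r.
split; first by rewrite /c' /next_carrier eqxx.
- by move=> r; have [] := key r.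
- by move=> r; have [] := key r.
move=> r c'M; have [_ _ edge] := key r.
have tS' := row_insert_tableau tS yS.
have := tab_col tS' r (c' r.+1); move: c'M.
case: edge => [[e1 nbet]|[e1 lt e0 eb lt0]]; rewrite /c' /next_carrier e1 ?eqxx ?(ltn_eqF lt).
  move=> pM; rewrite (ins_below (stS r)) ?(ins_below (stS r.+1)) // ?(ltnW pM) //.
  have := tight r pM; case: (ltnP (entering M S y r.+1) M) => oM; last by lia.
  by have [] := ins_bumped (stS r.+1) oM; lia.
move=> oM; rewrite (ins_below (stS r)) ?(ins_below (stS r.+1)) // ?(ltnW oM) //.
have pM := ltn_trans lt oM.
have := tight r pM; have := ins_mono (stS r.+1) lt.
have [] := ins_bumped (stS r.+1) oM.
have := ins_mono (stS r.+1) (leqnSn (entering M S y r.+1)).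
lia.
Qed.

(** * Prepending a letter to a word *)

Definition Ptab (w : seq nat) := foldl (fun T x => (row_insert T x).1) [::] w.

Lemma Ptab_rcons w x : Ptab (rcons w x) = (row_insert (Ptab w) x).1.
Proof. by rewrite /Ptab -cats1 foldl_cat. Qed.

Lemma Ptab_perm w : perm_eq (flatten (Ptab w)) w.
Proof.
elim/last_ind: w => // w x IH; rewrite Ptab_rcons.
have [M /andP[xM TM]] := bound_exists (x :: flatten (Ptab w)).
apply: (perm_trans (row_insert_perm TM xM)).
by rewrite perm_sym perm_rcons perm_cons perm_sym.
Qed.

Lemma Ptab_tableau w : uniq w -> tableau (Ptab w).
Proof.
elim/last_ind: w => [_|w x IH]; first exact: tableau_nil.
rewrite rcons_uniq Ptab_rcons => /andP[xw /IH tw].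
by apply: row_insert_tableau; rewrite ?(perm_mem (Ptab_perm w)).
Qed.

Lemma Ptab_bounded M w : all (fun e => e < M) w -> all (fun e => e < M) (flatten (Ptab w)).
Proof. by rewrite (perm_all _ (Ptab_perm w)). Qed.

(** Before any letter is read, the prepended letter is carried up from below to
the first row, past empty rows. *)
Lemma coupled_word M x u : uniq (x :: u) -> all (fun e => e < M) (x :: u) ->
  exists c, coupled M (Ptab u) (Ptab (x :: u)) c.
Proof.
elim/last_ind: u => [|u y IH].
  move=> _ /andP[xM _]; exists (fun r => if r == 0 then M else x).
  split=> // [[|r]|[|r] v vM|r _] //=; first exact: ltnW.
  - by rewrite /below /=; lia.
  - by rewrite !nth_nil /below /=; lia.
  - by rewrite !nth_nil.
rewrite -rcons_cons rcons_uniq all_rcons => /andP[yxu uxu] /andP[yM xuM].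
have [c cpl] := IH uxu xuM; exists (next_carrier M (Ptab u) (Ptab (x :: u)) c y).
move: (uxu) (yxu) (xuM); rewrite /= inE negb_or.
move=> /andP[xu uu] /andP[yx yu] /andP[xM uM].
rewrite -?rcons_cons !Ptab_rcons.
apply: (proj1 (coupled_insert (Ptab_tableau uu) (Ptab_tableau uxu) _ _ yM _ _ cpl)).
- exact: Ptab_bounded.
- exact: Ptab_bounded.
- by rewrite (perm_mem (Ptab_perm _)).
- by rewrite (perm_mem (Ptab_perm _)).
Qed.

Lemma nth_default_inj (T : eqType) (x0 : T) s1 s2 :
  x0 \notin s1 -> x0 \notin s2 -> (forall i, nth x0 s1 i = nth x0 s2 i) -> s1 = s2.
Proof.
move=> n1 n2 eq; apply: (eq_from_nth (x0 := x0)) => //; apply/eqP.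
rewrite eqn_leq; apply/andP; split; rewrite leqNgt; apply/negP => lt.
  by have := mem_nth x0 lt; rewrite eq nth_default // (negbTE n1).
by have := mem_nth x0 lt; rewrite -eq nth_default // (negbTE n2).
Qed.

(** * The local rule *)

(** A partition strictly between [be] and [ga] adds to [be] either the box added
by [mu] or the box [d] that leads from [mu] to [ga]. *)
Lemma local_ruleP al be ga mu b d : mu = incr_nth be b -> ga = incr_nth mu d ->
  is_partition mu -> b <= size be ->
  (incr_nth be d != al -> is_partition (incr_nth be d) -> d = b) ->
  local_rule al be ga = mu.
Proof.
move=> emu ega pmu bbe dP.
have mu_in : mu \in between be ga.
  rewrite mem_filter pmu ega emu map_f ?mem_iota // andbT.
  by apply/forallP => r; rewrite !nth_incr_nth leq_addl.
have only nu : nu \in between be ga -> nu != al -> nu = mu.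
  rewrite mem_filter => /andP[/andP[pnu sub] /mapP[r _ enu]] ne.
  have rs : r < size nu by rewrite enu size_incr_nth; case: ifP.
  have := forallP sub (Ordinal rs); rewrite /= ega emu enu !nth_incr_nth eqxx.
  case: (eqVneq b r) => [->//|_]; case: (eqVneq d r) => [edr _|]; last by lia.
  by rewrite -edr in enu *; rewrite dP // -enu.
rewrite /local_rule; set f := [seq _ <- _ | _].
case E: f => [|nu f'] /=; last first.
  have : nu \in f by rewrite E mem_head.
  by rewrite mem_filter => /andP[ne nuin]; exact: only.
have al_only nu : nu \in between be ga -> nu = al.
  move=> nuin; apply/eqP/negPn/negP => ne.
  by have : nu \in f; [rewrite mem_filter ne | rewrite E].
rewrite (al_only _ mu_in); apply: al_only.
by case: (between be ga) mu_in => //= nu s _; rewrite mem_head.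
Qed.

(** The additional box of [R] is in the row where the carried letters become
infinite; in any other row, one entry is traded for another. *)
Lemma coupled_shape M S R c : tableau S -> tableau R ->
  all (fun e => e < M) (flatten S) -> all (fun e => e < M) (flatten R) ->
  size (flatten R) = (size (flatten S)).+1 -> coupled M S R c ->
  exists a, [/\ c a = M, c a.+1 < M & shape R = incr_nth (shape S) a].
Proof.
move=> tS tR SM RM szR cpl.
have szE r : size (nth [::] R r) = size (nth [::] S r) + (c r.+1 < M <= c r).
  by rewrite -(below_size (all_row r SM)) -(below_size (all_row r RM)) (cpl_row cpl).
have /andP[_ S0] := tableau_shape tS; have /andP[_ R0] := tableau_shape tR.
have [a aP] : exists a, c a.+1 < M <= c a.
  have : has (fun r => c r.+1 < M <= c r) (iota 0 (size R)).
    apply/negPn/negP => /hasPn no.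
    have eqs : shape R = shape S.
      apply: (nth_default_inj (x0 := 0)) => // r; rewrite !nth_shape szE.
      case: (ltnP r (size R)) => rR; first by rewrite (negbTE (no r _)) ?mem_iota // addn0.
      by have := szE r; rewrite nth_default //=; lia.
    by move: szR; rewrite !size_flatten eqs; lia.
  by case/hasP => a _ aP; exists a.
exists a; have caM := cpl_le a cpl; split; [lia|lia|].
have aS : a <= size (shape S).
  rewrite leqNgt; apply/negP; rewrite size_map => Sa.
  have Sa1 : size S <= a.-1 by lia.
  have := szE a; rewrite [nth _ S a]nth_default ?(ltnW Sa) //= aP => sza.
  have := size_row_nonincr a.-1 tR; rewrite (ltn_predK Sa) sza szE.
  rewrite [nth _ S _]nth_default //= (ltn_predK Sa).
  by lia.
apply: (nth_default_inj (x0 := 0)) => //.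
  apply/negP => /(nthP 0)[r]; rewrite size_incr_nth nth_incr_nth => rs.
  case: eqVneq => //= ne /eqP e0; move: S0 => /negP; apply; apply/(nthP 0).
  exists r; last exact/eqP.
  move: rs ne aS; set m := size (shape S); case: (ltnP a m) => am; first by lia.
  by rewrite ltnS leq_eqVlt => /predU1P[->|]; rewrite ?eqxx //; lia.
move=> r; rewrite nth_incr_nth !nth_shape szE addnC; congr (_ + _).
case: eqP => [<-|ne]; first by rewrite aP.
have mono i j : i <= j -> c j <= c i.
  elim: j => [|j IH]; first by rewrite leqn0 => /eqP->.
  rewrite leq_eqVlt => /predU1P[->//|]; rewrite ltnS => /IH; exact: leq_trans (cpl_dec cpl j).
by have := mono a.+1 r; have := mono r.+1 a; lia.
Qed.

Lemma incr_nth2_eq s a j b d :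
  incr_nth (incr_nth s a) j = incr_nth (incr_nth s b) d -> d != a ->
  j = d /\ b = a.
Proof.
move=> /(congr1 (nth 0)) eq da; have {}eq r : (j == r) + (a == r) = (d == r) + (b == r).
  have := congr1 (@^~ r) eq; rewrite /= !nth_incr_nth !addnA.
  exact: addIn.
have jd : j = d.
  have := eq d; rewrite eqxx [a == d]eq_sym (negbTE da) addn0.
  by case: (eqVneq j d).
by split=> //; have := eq a; rewrite jd eqxx => /addnI; case: (eqVneq b a).
Qed.

(** Above row [a] both tableaux are treated alike, and the letter that enters row
[a] is appended to that row of [S]. In [R] either it is appended too, or it bumps
the letter [c a.+1]. In the second case [c a.+1] exceeds row [a] of [S], and
[cpl_tight] says that row [a.+1] of [S] is as long and has no larger entry, so
that [c a.+1] is appended to it. *)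
Lemma second_box_adjacent M S R c y a : tableau S -> tableau R ->
  all (fun e => e < M) (flatten S) -> all (fun e => e < M) (flatten R) ->
  y < M -> y \notin flatten S -> y \notin flatten R -> coupled M S R c ->
  c a = M -> c a.+1 < M -> (row_insert S y).2 = a ->
  (row_insert R y).2 = a \/
  (row_insert R y).2 = a.+1 /\ size (nth [::] S a) <= size (nth [::] S a.+1).
Proof.
move=> tS tR SM RM yM yS yR cpl caM ca1 eba.
have [_ edges] := coupled_insert tS tR SM RM yM yS yR cpl.
have idxS r := row_insert_idx r SM yM; have idxR r := row_insert_idx r RM yM.
have inSa : entering M S y a < M by rewrite -idxS eba.
have inSa1 : entering M S y a.+1 = M.
  apply/eqP; rewrite eqn_leq entering_le ?(ltnW yM) // leqNgt -(idxS a.+1).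
  by rewrite eba ltnn.
have inRa : entering M R y a = entering M S y a.
  case: (a) caM => // r cr; case: (edges r) => [[]//|[_ lt _ _ _]].
  by have := leq_trans lt (entering_le r.+1 SM (ltnW yM)); rewrite cr ltnn.
have aj : a <= (row_insert R y).2 by rewrite idxR inRa.
case: (edges a) => [[e1 _]|[e1 lt _ eb _]].
  by left; apply/eqP; rewrite eqn_leq aj andbT leqNgt idxR e1 inSa1 ltnn.
right; split.
  have inRa1 : entering M R y a.+1 < M by rewrite e1.
  have inRa2 : entering M R y a.+2 = M.
    case: (edges a.+1) => [[-> _]|[_ _ e0 _ _]].
      rewrite [entering _ _ _ _.+2]/= -[bumped _ (nth _ _ a) _]/(entering M S y a.+1) inSa1.
      by apply: bumped_ge => //; exact: all_row.
    by rewrite e0 inSa1 ltnn in inRa1.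
  by apply/eqP; rewrite eqn_leq idxR inRa1 andbT leqNgt idxR inRa2 ltnn.
have := eb; rewrite inSa1 (below_size (all_row a SM)) (cpl_tight cpl) // => ->.
exact: below_le_size.
Qed.

(** If the boxes added to [Ptab u] by [x] and by [y] differ, then the second one
gives the only partition other than that of [x :: u]. If they coincide, the local
rule must have no choice, which [second_box_adjacent] shows: the box [d] lies
either next to the common box [a] or just below it, in a row which may not grow
before row [a] does. *)
Lemma local_rule_word x u y : uniq (x :: rcons u y) ->
  local_rule (shape (Ptab (x :: u))) (shape (Ptab u))
    (shape (Ptab (x :: rcons u y))) = shape (Ptab (rcons u y)).
Proof.
move=> un; have [M bM] := bound_exists (x :: rcons u y).
move: (un) (bM); rewrite -rcons_cons rcons_uniq all_rcons.
move=> /andP[yxu uxu] /andP[yM xuM].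
have [c cpl] := coupled_word uxu xuM.
have [c' cpl'] := coupled_word un bM.
have /andP[_ uu] := uxu; have /andP[_ uM] := xuM.
have yu : y \notin u by apply: contra yxu; rewrite inE => ->; rewrite orbT.
have tS := Ptab_tableau uu; have tR := Ptab_tableau uxu.
have SM := Ptab_bounded uM; have RM := Ptab_bounded xuM.
have yS : y \notin flatten (Ptab u) by rewrite (perm_mem (Ptab_perm _)).
have yR : y \notin flatten (Ptab (x :: u)) by rewrite (perm_mem (Ptab_perm _)).
have szP w : size (flatten (Ptab w)) = size w by rewrite (perm_size (Ptab_perm w)).
have [a [caM ca1 shR]] : exists a, [/\ c a = M, c a.+1 < M &
    shape (Ptab (x :: u)) = incr_nth (shape (Ptab u)) a].
  by apply: coupled_shape cpl => //; rewrite !szP.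
have [d [_ _ shR']] : exists d, [/\ c' d = M, c' d.+1 < M &
    shape (Ptab (x :: rcons u y)) = incr_nth (shape (Ptab (rcons u y))) d].
  move: (un) => /andP[_ uuy]; move: (bM) => /andP[_ uyM].
  apply: coupled_shape cpl'; rewrite ?szP //; try exact: Ptab_tableau.
    exact: Ptab_bounded.
  exact: Ptab_bounded.
have shS' : shape (Ptab (rcons u y)) =
    incr_nth (shape (Ptab u)) (row_insert (Ptab u) y).2.
  by rewrite Ptab_rcons row_insert_shape.
have shR'' : shape (Ptab (x :: rcons u y)) =
    incr_nth (shape (Ptab (x :: u))) (row_insert (Ptab (x :: u)) y).2.
  by rewrite -rcons_cons Ptab_rcons row_insert_shape.
have box := @second_box_adjacent M _ _ c y a tS tR SM RM yM yS yR cpl caM ca1.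
have bS := row_insert_idx_le (Ptab u) y; rewrite -(size_map size) in bS.
move: shS' shR'' bS box; set b := (row_insert (Ptab u) y).2.
set j := (row_insert _ _).2 => shS' shR'' bS box.
apply: (local_ruleP shS' shR') => //.
  by apply/tableau_shape/Ptab_tableau; case/andP: un.
rewrite shR => ne pd; have da : d != a by apply: contra ne => /eqP->.
have [ejd eba] : j = d /\ b = a.
  apply: (@incr_nth2_eq (shape (Ptab u))) da.
  by rewrite -shR -shS' -shR' -shR''.
case: (box eba) => [eja|[eja szE]]; first by rewrite -ejd eja eqxx in da.
move: pd; rewrite -ejd eja => /andP[/(sortedP 0)/(_ a) + _].
rewrite !nth_incr_nth !nth_shape size_incr_nth eqxx (gtn_eqF (ltnSn a)) add0n add1n.
move=> so; have : size (nth [::] (Ptab u) a.+1) < size (nth [::] (Ptab u) a).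
  by apply: so; case: (ltnP a.+1 (size (shape (Ptab u)))).
by rewrite ltnNge szE.
Qed.

(** * Recording tableaux and growth diagrams *)

Definition add_box (T : seq (seq nat)) i v :=
  set_nth [::] T i (rcons (nth [::] T i) v).

Lemma nth_add_box T i v r :
  nth [::] (add_box T i v) r = if r == i then rcons (nth [::] T i) v else nth [::] T r.
Proof. by rewrite nth_set_nth. Qed.

Lemma shape_add_box T i v : shape (add_box T i v) = incr_nth (shape T) i.
Proof.
rewrite /add_box; elim: T i => [|s T IH] [|i] //=; rewrite ?size_rcons //.
- by congr (_ :: _); elim: i => //= i ->.
- by rewrite IH.
Qed.

Lemma add_box_perm T i v : perm_eq (flatten (add_box T i v)) (v :: flatten T).
Proof.
rewrite /add_box; elim: T i => [|s T IH] [|i] //=.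
- by elim: i => //= i IH.
- by rewrite -cat_cons perm_cat2r perm_rcons.
apply: (perm_trans (y := s ++ v :: flatten T)); first by rewrite perm_cat2l; exact: IH.
exact: permEl (perm_catCA s [:: v] (flatten T)).
Qed.

Lemma add_box_nonnil T i v : i <= size T -> [::] \notin T -> [::] \notin add_box T i v.
Proof.
rewrite /add_box; elim: T i => [|s T IH] [|i] //= iT; rewrite !inE !negb_or.
  by case/andP=> _ ->; rewrite andbT; case: (s).
by case/andP=> -> T0; exact: IH.
Qed.

Lemma iota1S n : iota 1 n.+1 = rcons (iota 1 n) n.+1.
Proof. by rewrite -[n.+1]addn1 iotaD cats1 addnC. Qed.

Lemma RS_rcons w x : RS (rcons w x) =
  ((row_insert (RS w).1 x).1, add_box (RS w).2 (row_insert (RS w).1 x).2 (size w).+1).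
Proof.
rewrite /RS size_rcons iota1S zip_rcons ?size_iota //.
rewrite -cats1 foldl_cat /=; case: foldl => P Q /=.
by rewrite /RS_step /=; case: row_insert.
Qed.

Lemma RS_P w : (RS w).1 = Ptab w.
Proof. by elim/last_ind: w => // w x IH; rewrite RS_rcons Ptab_rcons IH. Qed.

Lemma RS_Q_rcons w x : (RS (rcons w x)).2 =
  add_box (RS w).2 (row_insert (Ptab w) x).2 (size w).+1.
Proof. by rewrite RS_rcons RS_P. Qed.

Lemma RS_shape w : shape (RS w).2 = shape (Ptab w).
Proof.
elim/last_ind: w => // w x IH.
by rewrite RS_Q_rcons shape_add_box IH Ptab_rcons row_insert_shape.
Qed.

Lemma RS_size w : size (RS w).2 = size (Ptab w).
Proof. by rewrite -(size_map size) -/(shape _) RS_shape size_map. Qed.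

Lemma RS_Q_perm w : perm_eq (flatten (RS w).2) (iota 1 (size w)).
Proof.
elim/last_ind: w => // w x IH; rewrite RS_Q_rcons size_rcons.
apply: (perm_trans (add_box_perm _ _ _)).
rewrite iota1S perm_sym perm_rcons perm_cons.
by rewrite perm_sym.
Qed.

Lemma RS_Q_nonnil w : [::] \notin (RS w).2.
Proof.
elim/last_ind: w => // w x IH; rewrite RS_Q_rcons; apply: add_box_nonnil => //.
by rewrite RS_size row_insert_idx_le.
Qed.

Lemma shape_upto_add_box T i v j : j < v -> shape_upto (add_box T i v) j = shape_upto T j.
Proof.
move=> jv; have vj : (v <= j) = false by rewrite leqNgt jv.
rewrite /shape_upto /add_box; elim: T i => [|s T IH] [|i] //=.
- by rewrite vj.
- by elim: i => [|i IH] //=; rewrite vj.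
- by rewrite -cats1 count_cat /= vj !addn0.
- by case: ifP => _; rewrite IH.
Qed.

Lemma shape_upto_full T j : [::] \notin T -> all (fun e => e <= j) (flatten T) ->
  shape_upto T j = shape T.
Proof.
rewrite /shape_upto; elim: T => //= s T IH; rewrite inE negb_or all_cat.
move=> /andP[s0 T0] /andP[sj Tj]; rewrite IH //.
have -> : count (fun e => e <= j) s = size s by apply/eqP; rewrite -all_count.
by rewrite lt0n size_eq0 eq_sym s0.
Qed.

Lemma shape_upto_RS w j : j <= size w -> shape_upto (RS w).2 j = shape (Ptab (take j w)).
Proof.
elim/last_ind: w => [|w x IH]; first by rewrite leqn0 => /eqP->.
rewrite size_rcons leq_eqVlt => /predU1P[->|].
  rewrite take_oversize ?size_rcons // -RS_shape; apply: shape_upto_full.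
    exact: RS_Q_nonnil.
  by apply/allP => e; rewrite (perm_mem (RS_Q_perm _)) mem_iota size_rcons; lia.
rewrite ltnS => jw; rewrite RS_Q_rcons shape_upto_add_box // IH //.
by rewrite -cats1 takel_cat.
Qed.

Lemma growth1_RS x u j : uniq (x :: u) -> j <= size u ->
  growth (RS (x :: u)).2 1 j.+1 = shape (Ptab (take j u)).
Proof.
move=> un; elim: j => [|j IH] ju; first by rewrite take0.
set Q := (RS _).2.
rewrite -[LHS]/(local_rule (growth Q 0 j.+1) (growth Q 1 j.+1) (growth Q 0 j.+2)).
rewrite IH ?(ltnW ju) // [growth Q 0]/= !shape_upto_RS //; last by rewrite ltnW.
rewrite -![take _.+1 (x :: u)]/(x :: take _ u) (take_nth 0 ju).
apply: local_rule_word; rewrite -(take_nth 0 ju) -[x :: _]/(take j.+2 (x :: u)).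
exact: take_uniq.
Qed.

(** The entry [n] of the evacuated tableau is in the box by which Lambda_(0,n)
exceeds Lambda_(1,n). *)
Lemma evac_last Q n : 0 < n -> sumn (shape Q) = n -> 0 < size (growth Q 0 n) ->
  (last 0 (head [::] (evac Q)) = n) <->
  nth 0 (growth Q 1 n) 0 < nth 0 (growth Q 0 n) 0.
Proof.
move=> n0 szQ sz; rewrite /evac szQ /chain_tableau subnn.
case E: (size _) sz => [//|k] _; rewrite [head _ _]/=.
have -> : iota 1 n = rcons (iota 1 n.-1) n by case: (n) n0 => // m _; exact: iota1S.
rewrite filter_rcons subnn.
have -> : n - n.-1 = 1 by rewrite -{1}(prednK n0) subSnn.
set s := [seq _ <- _ | _].
have ls : last 0 s < n.
  have : last 0 s \in 0 :: iota 1 n.-1.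
    have := mem_last 0 s; rewrite !inE => /predU1P[->//|]; rewrite mem_filter.
    by case/andP=> _ ->; rewrite orbT.
  by rewrite inE mem_iota; lia.
by case: ifP => _; rewrite ?last_rcons //; split=> // e; rewrite e ltnn in ls.
Qed.

(** * Increasing subsequences and descents *)

Lemma subseq_rcons_rcons (T : eqType) (s w : seq T) y x :
  subseq (rcons s y) (rcons w x) =
  if y == x then subseq s w else subseq (rcons s y) w.
Proof.
by rewrite -[LHS]subseq_rev !rev_rcons /=; case: eqP => _; rewrite -?rev_rcons subseq_rev.
Qed.

Lemma sorted_ltn_rcons s x :
  sorted ltn (rcons s x) = all (fun e => e < x) s && sorted ltn s.
Proof. by rewrite !(sorted_pairwise ltn_trans) pairwise_rcons. Qed.

(** The bound [v] on the letters of the subsequence makes Schensted's theorem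
inductive: [x] can be appended to an increasing subsequence with letters less
than [x]. *)
Lemma schensted_below M w v : uniq w -> all (fun e => e < M) w -> v <= M ->
  (exists s, [/\ subseq s w, sorted ltn s, all (fun e => e < v) s
             & size s = below (nth [::] (Ptab w) 0) v]) /\
  (forall s, subseq s w -> sorted ltn s -> all (fun e => e < v) s ->
     size s <= below (nth [::] (Ptab w) 0) v).
Proof.
elim/last_ind: w v => [|w x IH] v.
  move=> _ _ _; split; first by exists [::].
  by move=> s; rewrite subseq0 => /eqP->.
rewrite rcons_uniq all_rcons => /andP[xw uw] /andP[xM wM] vM.
have xP : x \notin flatten (Ptab w) by rewrite (perm_mem (Ptab_perm w)).
have unP : uniq (x :: flatten (Ptab w)) by rewrite /= xP (perm_uniq (Ptab_perm w)).
have st := row_insertP 0 (tab_sorted (Ptab_tableau uw)) (Ptab_bounded wM) xM unP.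
have [/andP[xo oM] No Nx oS] := ins_bumped st xM; rewrite /= in oS No oM xo Nx.
rewrite Ptab_rcons (ins_below st vM) /=; set o := bumped _ _ _ in xo oM No oS *.
have [[s0 [ss0 so0 sv0 sz0]] max0] := IH v uw wM vM.
have [[s1 [ss1 so1 sv1 sz1]] max1] := IH x uw wM (ltnW xM).
split.
  case xvo: (x < v <= o); last first.
    exists s0; split=> //; last by rewrite addn0.
    exact: subseq_trans ss0 (subseq_rcons _ _).
  have /andP[xv vo] := xvo; exists (rcons s1 x); split.
  - by rewrite subseq_rcons_rcons eqxx.
  - rewrite sorted_ltn_rcons so1 andbT; exact: sv1.
  - rewrite all_rcons xv; apply: sub_all sv1 => e /= ex; exact: ltn_trans xv.
  - rewrite size_rcons sz1 addn1; congr _.+1.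
    apply/eqP; rewrite eqn_leq (ins_mono st (ltnW xv)) andTb.
    by rewrite (leq_trans (ins_mono st vo)) // No Nx.
move=> s; case/lastP: s => [//|s y].
rewrite subseq_rcons_rcons; case: eqP => [->|_] ss so; last first.
  by move=> sv; apply: leq_trans (max0 _ ss so sv) _; exact: leq_addr.
rewrite all_rcons size_rcons => /andP[xv sv].
move: so; rewrite sorted_ltn_rcons => /andP[sx so].
have le1 := max1 _ ss so sx.
case: (leqP v o) => vo.
  by rewrite xv addn1 ltnS (leq_trans le1) // (ins_mono st) // ltnW.
rewrite andbF addn0; apply: leq_trans (ins_mono st vo).
by rewrite oS ?(leq_trans vo) // ltnS No Nx.
Qed.

Definition row1 w := size (nth [::] (Ptab w) 0).

Lemma row1_below M w : all (fun e => e < M) w ->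
  below (nth [::] (Ptab w) 0) M = row1 w.
Proof. by move=> wM; apply/below_size/all_row/Ptab_bounded. Qed.

Lemma row1_attained w : uniq w ->
  exists s, [/\ subseq s w, sorted ltn s & size s = row1 w].
Proof.
move=> uw; have [M wM] := bound_exists w.
have [[s [ss so _ sz]] _] := schensted_below uw wM (leqnn M).
by exists s; rewrite sz row1_below.
Qed.

Lemma row1_max w s : uniq w -> subseq s w -> sorted ltn s -> size s <= row1 w.
Proof.
move=> uw ss so; have [M wM] := bound_exists w.
rewrite -(row1_below wM); apply: (schensted_below uw wM (leqnn M)).2 => //.
by apply/allP => e /(mem_subseq ss)/(allP wM).
Qed.

Lemma subword_subseq n (pi : 'S_n) I : subseq (subword pi I) (word pi).
Proof. by apply: map_subseq; rewrite enum_setT; exact: filter_subseq. Qed.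

Lemma subseq_subword n (pi : 'S_n) s : subseq s (word pi) ->
  exists I : {set 'I_n}, subword pi I = s.
Proof.
case/subseqP => m; rewrite size_map => szm ->.
set e := enum _ in szm *; pose t := mask m e.
have st : subseq t e by exact: mask_subseq.
have ue : uniq e by exact: enum_uniq.
exists [set i in t]; rewrite /subword -map_mask; congr map.
rewrite -/t [RHS](mask_filter _ ue) -/t /e enum_setT.
by apply: eq_filter => i; rewrite !inE.
Qed.

Lemma size_subword n (pi : 'S_n) I : size (subword pi I) = #|I|.
Proof. by rewrite size_map -cardE. Qed.

Lemma word_uniq n (pi : 'S_n) : uniq (word pi).
Proof. by rewrite map_inj_uniq ?enum_uniq // => i j [] /val_inj/perm_inj. Qed.

Lemma lis_row1 n (pi : 'S_n) : lis pi = row1 (word pi).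
Proof.
apply/eqP; rewrite eqn_leq; apply/andP; split.
  apply/bigmax_leqP => I so; rewrite -(size_subword pi).
  by apply: row1_max => //; [exact: word_uniq | exact: subword_subseq].
have [s [ss so <-]] := row1_attained (word_uniq pi).
have [I eI] := subseq_subword ss; rewrite -eI size_subword.
by apply: (bigmax_sup I); rewrite ?eI.
Qed.

Lemma mem_Des s i :
  (i \in Des s) = (0 < i < size s) && (nth 0 s i < nth 0 s i.-1).
Proof. by rewrite !inE mem_iota add1n; congr (_ && _); case: (size s) => [|n]; lia. Qed.

Lemma Des_1P s : uniq s -> Des s = [fset 1]%fset <->
  exists x t, [/\ s = x :: t, head 0 t < x, sorted ltn t & t != [::]].
Proof.
move=> us; split=> [/fsetP Ds|[x [[|y t] [-> //= yx so _]]]].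
  have := Ds 1; rewrite mem_Des !inE eqxx; case: s us Ds => [|x [|y t]] //= us Ds /esym yx.
  exists x, (y :: t); split=> //; apply/(sortedP 0) => i it /=.
  have := Ds i.+2; rewrite mem_Des inE /= ltnS it /= => /negbT.
  rewrite -leqNgt leq_eqVlt => /predU1P[e|//].
  move: us => /andP[_] us.
  by have := nth_uniq 0 (ltnW it) it us; rewrite e eqxx => /esym; rewrite eqn_leq ltnn andbF.
apply/fsetP => i; rewrite mem_Des !inE; case: i => [|[|i]] //=.
apply/negbTE; rewrite negb_and -!leqNgt; case: (ltnP i.+2 (size t).+2) => //= it.
have {}so : sorted ltn (y :: t) := so.
by move/(sortedP 0): so => /(_ i it)/ltnW.
Qed.

(** A longest increasing subsequence that avoids the first letter [x] of the word
starts below [x], for otherwise [x] would prolong it; together with [x] it has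
descent set {1}. *)
Lemma ls1_row1 n (pi : 'S_n) : 0 < n ->
  (ls [fset 1]%fset pi < lis pi + 1) = (row1 (behead (word pi)) < row1 (word pi)).
Proof.
move=> n0; rewrite addn1 ltnS lis_row1.
have uw := word_uniq pi; have : size (word pi) = n.
  by rewrite size_subword cardsT card_ord.
case E: (word pi) uw => [|x u] uw szw; first by rewrite -szw in n0.
rewrite [behead _]/=; have /andP[xu uu] := uw.
apply/idP/idP.
  rewrite !ltnNge; apply: contraL => le.
  have [s [ss so sz]] := row1_attained uu.
  have L0 : 0 < row1 (x :: u).
    by rewrite (@row1_max _ [:: x]) //= eqxx sub0seq.
  have sx : head 0 s < x.
    case: s ss so sz => [|y s] ss so sz; first by rewrite -sz leqn0 -leqn0 leqNgt L0 in le.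
    rewrite /= ltn_neqAle; apply/andP; split.
      by apply: contraNneq xu => <-; apply: (mem_subseq ss); rewrite mem_head.
    rewrite leqNgt; apply/negP => xy.
    have := @row1_max (x :: u) (x :: y :: s) uw; rewrite /= eqxx ss xy (so : path ltn y s).
    by move=> /(_ isT isT); rewrite -[(size s).+1]/(size (y :: s)) sz ltnNge le.
  have sub : subseq (x :: s) (word pi) by rewrite E /= eqxx.
  have [I eI] := subseq_subword sub.
  have DI : Des (subword pi I) == [fset 1]%fset.
    rewrite eI; apply/eqP/Des_1P; first by rewrite (subseq_uniq sub) ?word_uniq.
    exists x, s; split=> //.
    by apply: contraTneq le => s0; rewrite -sz s0 -ltnNge.
  rewrite -ltnNge; apply: (bigmax_sup I) => //.
  by rewrite -(size_subword pi) eI /= sz ltnS.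
move=> lt; apply/bigmax_leqP => I /eqP.
case/Des_1P => [|y [t [eI yt so t0]]].
  by apply: subseq_uniq (subword_subseq pi I) (word_uniq pi).
rewrite -(size_subword pi) eI /=; apply: leq_ltn_trans lt; apply: row1_max => //.
have := subword_subseq pi I; rewrite eI E /=; case: eqP => // _ ss.
exact: subseq_trans (subseq_cons _ _) ss.
Qed.

(** * Undoing a row insertion *)

(** The inserted letter is the largest entry less than [o] of the new row. *)
Lemma ins_spec_inj M N1 N2 N' y1 y2 o :
  ins_spec M N1 y1 N' o -> ins_spec M N2 y2 N' o -> y1 < M -> y2 < M -> y1 = y2.
Proof.
wlog lt : N1 N2 y1 y2 / y1 < y2.
  move=> H st1 st2 y1M y2M; case: (ltngtP y1 y2) => // lt.
    exact: H lt st1 st2 y1M y2M.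
  exact/esym/(H _ _ _ _ lt st2 st1).
move=> st1 st2 y1M y2M; exfalso.
have [/andP[yo1 oM] e1 e1' _] := ins_bumped st1 y1M.
have [/andP[yo2 _] _ _ _] := ins_bumped st2 y2M.
have mono := ins_mono st2 yo1.
have := ins_below st1 oM; rewrite (ins_below st2 oM).
have y1M' : y1.+1 <= M by [].
have := ins_below st1 y1M'; rewrite (ins_below st2 y1M'); move: lt yo1 yo2 e1 e1' mono.
clear; lia.
Qed.

Lemma below_minn M s v : all (fun e => e < M) s -> below s v = below s (minn v M).
Proof.
move=> sM; case: (leqP v M) => // /ltnW Mv.
by rewrite (below_size sM) (below_size (bounded_le Mv sM)).
Qed.

(** The letters of the bumping path, and with them the old rows, are recovered
from the bottom upwards. *)
Lemma row_insert_inj T1 T2 x1 x2 : tableau T1 -> tableau T2 ->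
  x1 \notin flatten T1 -> x2 \notin flatten T2 ->
  row_insert T1 x1 = row_insert T2 x2 -> T1 = T2 /\ x1 = x2.
Proof.
move=> tT1 tT2 xT1 xT2 eq12.
have [M] := bound_exists ((x1 :: flatten T1) ++ (x2 :: flatten T2)).
rewrite all_cat => /andP[/andP[x1M T1M] /andP[x2M T2M]].
have un1 : uniq (x1 :: flatten T1) by rewrite /= xT1 (tab_uniq tT1).
have un2 : uniq (x2 :: flatten T2) by rewrite /= xT2 (tab_uniq tT2).
have st1 r := row_insertP r (tab_sorted tT1) T1M x1M un1.
have st2 r := row_insertP r (tab_sorted tT2) T2M x2M un2.
have idx1 r := row_insert_idx r T1M x1M; have idx2 r := row_insert_idx r T2M x2M.
rewrite eq12 in st1 idx1; set i := (row_insert T2 x2).2 in idx1 idx2.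
have out r : i < r -> entering M T1 x1 r = M /\ entering M T2 x2 r = M.
  move=> ir; split; apply/eqP; rewrite eqn_leq entering_le ?(ltnW x1M) ?(ltnW x2M) //=.
    by rewrite leqNgt -idx1 -ltnNge.
  by rewrite leqNgt -idx2 -ltnNge.
have inpE r : entering M T1 x1 r = entering M T2 x2 r.
  case: (ltnP i r) => [/out[-> ->] // | ri].
  have := subnKC ri; move: (i - r) ri => k; elim: k r => [|k IH] r ri e.
    have eo : entering M T1 x1 r.+1 = entering M T2 x2 r.+1.
      have ir : i < r.+1 by rewrite ltnS -e addn0.
      by have [-> ->] := out _ ir.
    have := st1 r; rewrite eo => st1'.
    by apply: (ins_spec_inj st1' (st2 _)); rewrite -?idx1 -?idx2.
  have ri1 : r.+1 <= i by rewrite -e addnS ltnS leq_addr.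
  have eo := IH r.+1 ri1 (etrans (addSnnS r k) e).
  have := st1 r; rewrite eo => st1'.
  by apply: (ins_spec_inj st1' (st2 _)); rewrite -?idx1 -?idx2.
split; last exact: (inpE 0).
apply: (nth_default_inj (x0 := [::])); [exact: tab_nonnil tT1 | exact: tab_nonnil tT2 | move=> r].
apply: sorted_below_inj; [exact: tab_sorted | exact: tab_sorted | move=> v].
rewrite (below_minn _ (all_row r T1M)) (below_minn _ (all_row r T2M)).
have vM : minn v M <= M by exact: geq_minr.
apply: (@addIn (entering M T1 x1 r < minn v M <= entering M T1 x1 r.+1)).
by rewrite -(ins_below (st1 r) vM) (ins_below (st2 r) vM) !inpE.
Qed.

Lemma split_below s o : 0 < below s o -> o \notin s ->
  exists s1 y s2, [/\ s = s1 ++ y :: s2, y < o & all (fun e => o < e) s2].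
Proof.
elim: s => // e t IH; rewrite below_cons inE negb_or => pos /andP[eo ot].
case: (posnP (below t o)) => [t0|/IH/(_ ot)[s1 [y [s2 [-> yo s2o]]]]];
  last by exists (e :: s1), y, s2.
exists [::], e, t; split=> //; first by case: (ltnP e o) pos => //; rewrite t0.
apply/allP => z zt; rewrite ltn_neqAle; apply/andP; split.
  by apply: contraNneq ot => ->.
rewrite leqNgt; apply/negP => zo; move/eqP: t0.
by rewrite -leqn0 leqNgt -has_count; case/hasP; exists z.
Qed.

Lemma tableau_behead s T : tableau (s :: T) -> tableau T.
Proof.
case=> n0 un so col; split.
- by move: n0; rewrite inE negb_or => /andP[].
- by move: un; rewrite /= cat_uniq => /and3P[].
- by move=> r; exact: (so r.+1).
- by move=> r; exact: (col r.+1).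
Qed.

Lemma tableau_below_head s T o : tableau (s :: T) -> o \in flatten T -> 0 < below s o.
Proof.
elim: T s => // t T IH s tT; rewrite [flatten _]/= mem_cat.
have col := tab_col tT 0 o; rewrite /= in col.
have ut : uniq t := sorted_uniq ltn_trans ltnn (tab_sorted tT 1).
case/orP => [ot|oT]; apply: leq_trans col.
  by rewrite belowS // ot addn1.
by apply: leq_trans (IH _ (tableau_behead tT) oT) (below_mono _ (leqnSn o)).
Qed.

(** Reverse bumping: the letter [o] removed from the rows below takes the place of
the largest smaller entry [y] of the present row. Such an entry exists by the
column condition. *)
Lemma row_uninsert i T : tableau T -> i < size T ->
  size (nth [::] T i.+1) < size (nth [::] T i) ->
  exists T0 x, [/\ row_insert T0 x = (T, i), [::] \notin T0
                 & forall r, sorted ltn (nth [::] T0 r)].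
Proof.
elim: i T => [|i IH] [|s T] // tT; last first.
  rewrite /= ltnS => iT corner.
  have [T0 [o [ins0 n0 so0]]] := IH T (tableau_behead tT) iT corner.
  have [M /andP[oM T0M]] := bound_exists (o :: flatten T0).
  have oT : o \in flatten T.
    by have := perm_mem (row_insert_perm T0M oM) o; rewrite ins0 mem_head.
  have os : o \notin s.
    have := tab_uniq tT; rewrite /= cat_uniq => /and3P[_ /hasPn/(_ o oT)]; done.
  have [s1 [y [s2 [es yo s2o]]]] := split_below (tableau_below_head tT oT) os.
  have := tab_sorted tT 0; rewrite /= es !(sorted_pairwise ltn_trans) pairwise_cat /=.
  case/and4P=> rel12 pw1 ys2 pw2.
  have s1y : all (fun e => e < y) s1.
    by apply/allP => e es1; apply: (allrelP rel12) => //; rewrite mem_head.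
  exists ((s1 ++ o :: s2) :: T0), y; split.
  - have fE : find (fun z => y < z) (s1 ++ o :: s2) = size s1.
      rewrite find_cat /= yo addn0; case: hasP => // -[z /(allP s1y) zy /ltnW].
      by rewrite leqNgt zy.
    rewrite /= fE size_cat /= ltn_eqF ?addnS ?ltnS ?leq_addr //.
    rewrite nth_cat ltnn subnn /= ins0; congr (_ :: _, _).
    by elim: (s1) => //= a t ->.
  - rewrite inE negb_or n0 andbT; by case: (s1).
  - case=> [|r] /=; last exact: so0.
    rewrite (sorted_pairwise ltn_trans) pairwise_cat /= pw1 s2o pw2 !andbT.
    apply/allrelP => a b as1; rewrite inE => /predU1P[->|bs2].
      exact: ltn_trans (allP s1y _ as1) yo.
    by apply: (allrelP rel12) => //; rewrite inE bs2 orbT.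
move=> _ /=; case/lastP: s tT => [|s x] tT; first by have := tab_nonnil tT; rewrite inE.
have := tab_sorted tT 0; rewrite /= sorted_ltn_rcons => /andP[sx so].
case: s tT sx so => [|e s] tT sx so.
  rewrite ltnS leqn0 size_eq0 => T0; exists [::], x; split=> //.
    case: T tT T0 => // t T tT /= /eqP t0.
    by have := tab_nonnil tT; rewrite !inE t0 eqxx orbT.
  by move=> r; rewrite nth_nil.
move=> _; exists ((e :: s) :: T), x; split.
- rewrite [row_insert _ _]/=; have fE : find (fun z => x < z) (e :: s) = size (e :: s).
    apply/hasNfind/hasPn => z /(allP sx) /ltnW; by rewrite leqNgt.
  by move: fE; rewrite /= => ->; rewrite eqxx.
- by move: (tab_nonnil tT); rewrite !inE !negb_or => /andP[_ ->].
- by case=> [|r]; [exact: so | exact: (tab_sorted tT r.+1)].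
Qed.

(** The column condition could only fail for [v] in (y, o], where the upper row
loses [y]. Its count is constant there, hence it is enough to look at [o], and
there the lower row loses [o]. If [o] is infinite, the box removed from the upper
row is a corner, which is the last hypothesis. *)
Lemma col_uninsertion M NU NL NU' NL' y o o2 v :
  ins_spec M NU y NU' o -> ins_spec M NL o NL' o2 -> v < M -> y <= M -> o <= M ->
  NL' v.+1 <= NU' v -> NL' o.+1 <= NU' o ->
  (o = M -> y < M -> NL' M < NU' M) -> NL v.+1 <= NU v.
Proof.
move=> stU stL vM yM oM colv colo corner.
have monoU := ins_mono stU; have monoL := ins_mono stL.
have NUv := ins_below stU (ltnW vM); have NLv := ins_below stL vM.
have [/andP[yv vo]|out] := boolP (y < v <= o); last first.
  apply: leq_trans (_ : NU' v <= _); last by rewrite NUv (negbTE out) addn0.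
  by apply: leq_trans colv; rewrite NLv leq_addr.
have yM' : y < M by apply: ltn_trans yv vM.
have [_ eo _ _] := ins_bumped stU yM'.
have NUo := ins_below stU oM.
have ev : NU v = NU o by apply/eqP; rewrite eqn_leq monoU // eo monoU.
have yo : y < o <= o by rewrite leqnn andbT (leq_trans yv).
rewrite ev; have [oltM|Mo] := ltnP o M.
  have [oo2 _ _ _] := ins_bumped stL oltM.
  have NLo := ins_below stL oltM; rewrite NLo NUo ltnSn yo in colo.
  have vo1 : v.+1 <= o.+1 by [].
  apply: leq_trans (monoL _ _ vo1) _; move: colo oo2; clear; lia.
have eoM : o = M by apply/eqP; rewrite eqn_leq oM.
have := corner eoM yM'; rewrite -eoM NUo yo addn1 ltnS; apply: leq_trans.
by rewrite (ins_below stL oM) (leq_trans (monoL v.+1 o _)) ?leq_addr // eoM.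
Qed.

Lemma row_insert_surj i T : tableau T -> i < size T ->
  size (nth [::] T i.+1) < size (nth [::] T i) ->
  exists T0 x, [/\ row_insert T0 x = (T, i), tableau T0 & x \notin flatten T0].
Proof.
move=> tT iT corner; have [T0 [x [ins0 n0 so]]] := row_uninsert tT iT corner.
have [M0 bM0] := bound_exists (x :: flatten T0).
have un : uniq (x :: flatten T0).
  have /andP[xM TM] := bM0.
  by rewrite -(perm_uniq (row_insert_perm TM xM)) ins0 (tab_uniq tT).
have /andP[xT0 uT0] := un; exists T0, x; split=> //; split=> // r v.
have [M [xM T0M vM]] : exists M, [/\ x < M, all (fun e => e < M) (flatten T0) & v < M].
  exists (maxn M0 v.+1); have /andP[xM TM] := bounded_le (leq_maxl M0 v.+1) bM0.
  by rewrite leq_maxr.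
have st k := row_insertP k so T0M xM un; rewrite ins0 /= in st.
have TM : all (fun e => e < M) (flatten T).
  have := perm_all (fun e => e < M) (row_insert_perm T0M xM).
  by rewrite ins0 /= => ->; rewrite xM T0M.
have inpM k : entering M T0 x k <= M by apply: entering_le => //; apply: ltnW.
apply: (col_uninsertion (st r) (st r.+1)) => //; try exact: tab_col; first exact: (inpM r.+1).
move=> oM yM; rewrite !(below_size (all_row _ TM)).
suff -> : r = i by [].
have idx := row_insert_idx _ T0M xM.
have ri : r <= i by have := idx r; rewrite ins0 /= yM.
by apply/eqP; rewrite eqn_leq ri leqNgt; have := idx r.+1; rewrite ins0 /= oM ltnn => ->.
Qed.

(** * The Robinson-Schensted bijection *)

Lemma add_box_inj Q1 Q2 i1 i2 v : [::] \notin Q1 -> [::] \notin Q2 ->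
  v \notin flatten Q1 -> v \notin flatten Q2 ->
  add_box Q1 i1 v = add_box Q2 i2 v -> Q1 = Q2 /\ i1 = i2.
Proof.
have notin_row Q r : v \notin flatten Q -> v \notin nth [::] Q r.
  apply: contra => vr; apply/flattenP; exists (nth [::] Q r) => //.
  by apply: mem_nth; case: ltnP vr => // ?; rewrite nth_default.
move=> n1 n2 v1 v2 eq; have {}eq r := congr1 (fun Q => nth [::] Q r) eq.
have ei : i1 = i2.
  apply/eqP; apply: contraT => ne; have := eq i1.
  rewrite !nth_add_box eqxx (negbTE ne) => e; have := notin_row _ i1 v2.
  by rewrite -e mem_rcons mem_head.
split=> //; apply: (nth_default_inj (x0 := [::])) => // r; have := eq r; rewrite !nth_add_box ei.
by case: eqP => // -> /rcons_inj[].
Qed.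

Lemma add_box_tableau Q i v : tableau Q -> i <= size Q ->
  all (fun e => e < v) (flatten Q) -> is_partition (incr_nth (shape Q) i) ->
  tableau (add_box Q i v).
Proof.
move=> tQ iQ Qv part; split.
- exact/add_box_nonnil/(tab_nonnil tQ).
- rewrite (perm_uniq (add_box_perm _ _ _)) /= (tab_uniq tQ) andbT.
  by apply/negP => /(allP Qv); rewrite ltnn.
- move=> r; rewrite nth_add_box; case: eqP => _; last exact: tab_sorted.
  by rewrite sorted_ltn_rcons all_row // (tab_sorted tQ).
move=> r w; rewrite !nth_add_box.
have col := tab_col tQ r w.
have bel s u : below (rcons s v) u = below s u + (v < u).
  by rewrite /below -cats1 count_cat /= addn0.
have [eri|nri] := eqVneq r.+1 i; last first.
  by case: eqP => [<-|_] //; rewrite bel (leq_trans col) ?leq_addr.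
rewrite -eri (ltn_eqF (ltnSn r)) bel.
case: (ltnP v w.+1) => vw; last by rewrite addn0.
have /andP[so _] := part; have /(sortedP 0)/(_ r) := so.
rewrite !nth_incr_nth -eri eqxx (gtn_eqF (ltnSn r)) !nth_shape size_incr_nth.
have Qw : all (fun e => e < w) (flatten Q) by exact: bounded_le Qv.
rewrite (below_size (all_row r Qw)) (below_size (bounded_le (leqnSn w) (all_row r.+1 Qw))).
by rewrite addn1; apply; case: ifP.
Qed.

Lemma RS_Q_lt w : all (fun e => e < (size w).+1) (flatten (RS w).2).
Proof. by apply/allP => e; rewrite (perm_mem (RS_Q_perm w)) mem_iota; lia. Qed.

Lemma RS_Q_tableau w : uniq w -> tableau (RS w).2.
Proof.
elim/last_ind: w => [_|w x IH]; first exact: tableau_nil.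
move=> uwx; have := uwx; rewrite rcons_uniq RS_Q_rcons => /andP[_ /IH tQ].
apply: add_box_tableau => //; [by rewrite RS_size row_insert_idx_le | exact: RS_Q_lt |].
by rewrite RS_shape -row_insert_shape -Ptab_rcons; exact/tableau_shape/Ptab_tableau.
Qed.

Lemma RS_Q_size w : size (flatten (RS w).2) = size w.
Proof. by rewrite (perm_size (RS_Q_perm w)) size_iota. Qed.

Lemma RS_inj w1 w2 : uniq w1 -> uniq w2 -> RS w1 = RS w2 -> w1 = w2.
Proof.
move=> + + eq; have := congr1 (fun PQ => size (flatten PQ.2)) eq.
rewrite /= !RS_Q_size; move: eq.
elim/last_ind: w1 w2 => [|w1 x1 IH] w2; case/lastP: w2 => [|w2 x2]; rewrite ?size_rcons //.
move=> eq [sz]; rewrite !rcons_uniq => /andP[x1w u1] /andP[x2w u2].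
move: eq; rewrite [RS _]surjective_pairing [RS (rcons w2 _)]surjective_pairing.
rewrite !RS_P !RS_Q_rcons !Ptab_rcons sz => -[eP eQ].
have vQ w : (size w).+1 \notin flatten (RS w).2.
  by apply/negP => /(allP (RS_Q_lt w)); rewrite ltnn.
have [eQ0 ei] : (RS w1).2 = (RS w2).2 /\
    (row_insert (Ptab w1) x1).2 = (row_insert (Ptab w2) x2).2.
  by apply: add_box_inj eQ; rewrite ?RS_Q_nonnil // -1?sz vQ.
have [eT ->] : Ptab w1 = Ptab w2 /\ x1 = x2.
  apply: row_insert_inj; rewrite ?(perm_mem (Ptab_perm _)) //; try exact: Ptab_tableau.
  by rewrite [LHS]surjective_pairing [RHS]surjective_pairing eP ei.
by rewrite (IH w2) // [LHS]surjective_pairing [RHS]surjective_pairing !RS_P eT eQ0.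
Qed.

(** The largest entry is at the end of its row, and by the column condition at
that entry the next row is shorter. *)
Lemma SYT_remove_max m Q : tableau Q -> perm_eq (flatten Q) (iota 1 m.+1) ->
  exists Q0 i, [/\ Q = add_box Q0 i m.+1, tableau Q0, perm_eq (flatten Q0) (iota 1 m),
    i < size Q & size (nth [::] Q i.+1) < size (nth [::] Q i)].
Proof.
move=> tQ pQ; have : m.+1 \in flatten Q by rewrite (perm_mem pQ) mem_iota; lia.
case/flattenP => t tinQ mt; pose i := index t Q.
have iQ : i < size Q by rewrite index_mem.
have ti : nth [::] Q i = t by exact: nth_index.
have Qm : all (fun e => e < m.+2) (flatten Q).
  by apply/allP => e; rewrite (perm_mem pQ) mem_iota; lia.
have so := tab_sorted tQ i; have tm := all_row i Qm.
have corner : size (nth [::] Q i.+1) < size (nth [::] Q i).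
  have := tab_col tQ i m.+1; rewrite (below_size (all_row _ Qm)) => le.
  rewrite -(below_size tm) belowS ?(sorted_uniq ltn_trans ltnn) // ti mt addn1 ltnS.
  by rewrite -ti.
have [t0 et] : exists t0, t = rcons t0 m.+1.
  rewrite ti in so tm; case/lastP: t mt so tm {tinQ i iQ ti corner} => // t0 z.
  rewrite sorted_ltn_rcons all_rcons mem_rcons inE => mt /andP[t0z _] /andP[zm _].
  exists t0; congr rcons; apply/eqP; rewrite eqn_leq -ltnS zm /=.
  by case/predU1P: mt => [->//|/(allP t0z)/ltnW].
have nthQ0 : exists Q0, [/\ [::] \notin Q0, i <= size Q0 &
    forall r, nth [::] Q0 r = if r == i then t0 else nth [::] Q r].
  have n0 := tab_nonnil tQ.
  have [t00|t00] := eqVneq t0 [::].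
    exists (take i Q); split.
    - by apply: contra n0 => /mem_take.
    - by rewrite size_take iQ.
    move=> r; case: (ltngtP r i) => [ri|ir|->]; first by rewrite nth_take.
      rewrite nth_default ?size_take ?iQ ?(ltnW ir) //.
      suff szQ : size Q <= i.+1 by rewrite nth_default // (leq_trans szQ).
      rewrite leqNgt; apply/negP => iQ1; move: corner; rewrite ti et t00 /= ltnS leqn0.
      by rewrite size_eq0 => /eqP e; move: n0; rewrite -e mem_nth.
    by rewrite nth_default ?size_take ?iQ.
  exists (set_nth [::] Q i t0); split.
  - apply/negP => /(nthP [::])[r]; rewrite size_set_nth nth_set_nth /=.
    rewrite (maxn_idPr iQ); case: eqP => [_ _ e|_ rQ e]; first by rewrite e eqxx in t00.
    by move: n0; rewrite -e mem_nth.
  - by rewrite size_set_nth leq_max leqnSn.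
  - by move=> r; rewrite nth_set_nth.
case: nthQ0 => Q0 [n0 iQ0 nthQ0].
have eQ : Q = add_box Q0 i m.+1.
  apply: (nth_default_inj (x0 := [::])); [exact: tab_nonnil | exact: add_box_nonnil | move=> r].
  by rewrite nth_add_box !nthQ0 eqxx; case: eqP => // ->; rewrite ti.
have pQ0 : perm_eq (m.+1 :: flatten Q0) (m.+1 :: iota 1 m).
  rewrite -(permPl (add_box_perm Q0 i m.+1)) -eQ (permPl pQ) iota1S.
  by rewrite perm_rcons.
exists Q0, i; split=> //; last by move: pQ0; rewrite perm_cons.
rewrite perm_cons in pQ0; split=> //.
- by rewrite (perm_uniq pQ0) iota_uniq.
- move=> r; rewrite nthQ0; case: eqP => _; last exact: tab_sorted.
  by move: so; rewrite ti et sorted_ltn_rcons => /andP[].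
move=> r v; have col := tab_col tQ r v; rewrite !nthQ0.
have bel u : below (nth [::] Q i) u = below t0 u + (m.+1 < u).
  by rewrite ti et /below -cats1 count_cat /= addn0.
have [eri|nri] := eqVneq r.+1 i.
  rewrite -eri (ltn_eqF (ltnSn r)); apply: leq_trans col.
  by rewrite eri bel leq_addr.
case: eqP col => [->|//]; rewrite bel; case: (ltnP m.+1 v) => mv; last by rewrite addn0.
move=> _; have Qv := bounded_le mv Qm.
rewrite (below_size (bounded_le (leqnSn v) (all_row i.+1 Qv))).
have : all (fun e => e < v) t0.
  by have := all_row i Qv; rewrite ti et all_rcons => /andP[].
by move/below_size->; move: corner; rewrite ti et size_rcons.
Qed.

Lemma shape_nonnil (T : seq (seq nat)) : (0 \in shape T) = ([::] \in T).
Proof.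
apply/mapP/idP => [[s sT /esym/eqP]|T0]; last by exists [::].
by rewrite size_eq0 => /eqP <-.
Qed.

Lemma shape_incr_inj (T1 T2 : seq (seq nat)) i : [::] \notin T1 -> [::] \notin T2 ->
  incr_nth (shape T1) i = incr_nth (shape T2) i -> shape T1 = shape T2.
Proof.
rewrite -!shape_nonnil => n1 n2 eq; apply: (nth_default_inj (x0 := 0)) => // r.
by have := congr1 (nth 0 ^~ r) eq; rewrite !nth_incr_nth => /addnI.
Qed.

Lemma RS_surj m P Q : tableau P -> tableau Q -> shape P = shape Q ->
  perm_eq (flatten Q) (iota 1 m) -> exists w, uniq w /\ RS w = (P, Q).
Proof.
elim: m P Q => [|m IH] P Q tP tQ shPQ pQ.
  have Q0 : Q = [::].
    have /perm_nilP := pQ; case: (Q) tQ => // s T tQ /=.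
    by case: s tQ => [tQ|//]; have := tab_nonnil tQ; rewrite inE.
  exists [::]; split=> //; rewrite Q0; move: shPQ; rewrite Q0.
  by case: (P).
have [Q0 [i [eQ tQ0 pQ0 iQ corner]]] := SYT_remove_max tQ pQ.
have iP : i < size P by rewrite -(size_map size) -/(shape P) shPQ size_map.
have cornerP : size (nth [::] P i.+1) < size (nth [::] P i).
  by rewrite -!nth_shape shPQ !nth_shape.
have [T0 [x [insT tT0 xT0]]] := row_insert_surj tP iP cornerP.
have shT0 : shape T0 = shape Q0.
  apply: (@shape_incr_inj _ _ i); [exact: tab_nonnil | exact: tab_nonnil |].
  have := row_insert_shape T0 x; rewrite insT /= => <-.
  by rewrite shPQ eQ shape_add_box.
have [w [uw RSw]] := IH _ _ tT0 tQ0 shT0 pQ0.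
have PT : Ptab w = T0 by rewrite -RS_P RSw.
exists (rcons w x); rewrite rcons_uniq uw andbT -(perm_mem (Ptab_perm w)) PT; split=> //.
rewrite RS_rcons RSw /= insT /= eQ; congr (_, add_box _ _ _.+1).
by rewrite -(RS_Q_size w) RSw /= (perm_size pQ0) size_iota.
Qed.

Lemma is_SYT_tableau m T :
  is_SYT m T <-> tableau T /\ perm_eq (flatten T) (iota 1 m).
Proof.
split=> [/and4P[part pT rows cols]|[tT pT]].
  split=> //; have so r : sorted ltn (nth [::] T r).
    by case: (ltnP r (size T)) => rT; [apply: (allP rows); exact: mem_nth | rewrite nth_default].
  split=> //; first by have /andP[_] := part; rewrite shape_nonnil.
    by rewrite (perm_uniq pT) iota_uniq.
  move=> r v; have [rT|Tr] := ltnP r.+1 (size T); last by rewrite nth_default.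
  have /(sortedP [::])/(_ r rT)/forallP col := cols.
  case E: (below _ v.+1) => [//|c].
  have := ltnSn c; rewrite -{2}E sorted_below_nth // => /andP[cs cv].
  rewrite sorted_below_nth // (leq_trans (col (Ordinal cs))) // andbT.
  apply: leq_trans cs _; have /andP[/(sortedP 0)/(_ r) + _] := part.
  by rewrite size_map !nth_shape; apply.
apply/and4P; split=> //; first exact: tableau_shape.
  by apply/allP => s /(nthP [::])[r _ <-]; exact: tab_sorted.
apply/(sortedP [::]) => r rT; apply/forallP => -[c cs] /=.
have := tab_col tT r (nth 0 (nth [::] T r.+1) c).
have : c < below (nth [::] T r.+1) (nth 0 (nth [::] T r.+1) c).+1.
  by rewrite sorted_below_nth ?cs ?ltnSn //; exact: tab_sorted.
move=> lt /(leq_trans lt); rewrite sorted_below_nth; last exact: tab_sorted.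
by case/andP.
Qed.

(** * Counting the words *)

Definition SYTs la := [seq T <- [seq reshape la w | w <- permutations (iota 1 (sumn la))]
                      | is_SYT (sumn la) T].

Lemma size_SYTs la : size (SYTs la) = nb_SYT la.
Proof. by rewrite size_filter count_map. Qed.

Lemma SYTs_uniq la : uniq (SYTs la).
Proof.
apply: filter_uniq; rewrite map_inj_in_uniq ?permutations_uniq // => w1 w2.
rewrite !mem_permutations => /perm_size s1 /perm_size s2 /(congr1 flatten).
by rewrite !reshapeKr ?s1 ?s2 ?size_iota.
Qed.

Lemma mem_SYTs la T :
  T \in SYTs la <-> [/\ shape T = la, tableau T & perm_eq (flatten T) (iota 1 (sumn la))].
Proof.
rewrite mem_filter; split=> [/andP[/is_SYT_tableau[tT pT] /mapP[w pw eT]]|[sh tT pT]].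
  split=> //; rewrite eT reshapeKl //.
  by move: pw; rewrite mem_permutations => /perm_size->; rewrite size_iota.
apply/andP; split; first exact/is_SYT_tableau.
apply/mapP; exists (flatten T); first by rewrite mem_permutations.
by rewrite -sh flattenK.
Qed.

Definition last_in_row1 m w := row1 (take m w) < row1 w.

Lemma row1_rcons w x : (row1 w < row1 (rcons w x)) = ((row_insert (Ptab w) x).2 == 0).
Proof.
rewrite /row1 -!nth_shape Ptab_rcons row_insert_shape nth_incr_nth.
by case: eqP => _; rewrite ?add0n ?ltnn // add1n ltnSn.
Qed.

Lemma take_rcons m (w : seq nat) x : size w = m -> take m (rcons w x) = w.
Proof. by move=> <-; rewrite -cats1 take_size_cat. Qed.

Definition SYT_pairs m := [seq PQ | la <- partitions m,
  PQ <- [seq (P, Q) | P <- SYTs (add1 la), Q <- SYTs la]].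

Lemma size_SYT_pairs m :
  size (SYT_pairs m) = \sum_(la <- partitions m) nb_SYT (add1 la) * nb_SYT la.
Proof.
rewrite size_allpairs_dep sumnE big_map; apply: eq_bigr => la _.
by rewrite size_allpairs !size_SYTs.
Qed.

Lemma mem_SYT_pairs m P Q : (P, Q) \in SYT_pairs m <->
  [/\ shape P = add1 (shape Q), tableau P, tableau Q,
      perm_eq (flatten P) (iota 1 m.+1) & perm_eq (flatten Q) (iota 1 m)].
Proof.
have sumn_add1 la : sumn (add1 la) = (sumn la).+1 by case: la => [|a la] /=.
split=> [/allpairsPdep[la [PQ [pla /allpairsP[[P' Q'] /= [PP QQ ->]] [-> ->]]]]|[shP tP tQ pP pQ]].
  move: pla; rewrite mem_partitions => /andP[_ /eqP sla].
  have [shP tP pP] := (mem_SYTs _ _).1 PP; have [shQ tQ pQ] := (mem_SYTs _ _).1 QQ.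
  by rewrite sumn_add1 sla in pP; rewrite sla in pQ; rewrite shP shQ.
have sQ : sumn (shape Q) = m by rewrite -size_flatten (perm_size pQ) size_iota.
apply/allpairsPdep; exists (shape Q), (P, Q); split=> //.
  by rewrite mem_partitions tableau_shape // sQ eqxx.
apply/allpairsP; exists (P, Q); split=> //=; apply/mem_SYTs; split=> //.
  by rewrite sumn_add1 sQ.
by rewrite sQ.
Qed.

Lemma SYT_pairs_uniq m : uniq (SYT_pairs m).
Proof.
apply: allpairs_uniq_dep; first exact: partitions_uniq.
  move=> la _; apply: allpairs_uniq; rewrite ?SYTs_uniq // => -[P Q] [P' Q'] _ _ /=.
  by case=> -> ->.
move=> _ _ /allpairsPdep[la [PQ [_ PQin ->]]] /allpairsPdep[mu [PQ' [_ PQ'in ->]]] /= e.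
move: PQin PQ'in; rewrite -e => /allpairsP[[P Q] /= [_ /mem_SYTs[sh _ _] ->]].
case/allpairsP=> -[P' Q'] /= [_ /mem_SYTs[sh' _ _] [_ eQ]].
by rewrite -sh -sh' eQ.
Qed.

(** The recording tableau of the whole word is left out: if the last letter is
inserted into the first row, it is determined by that of the word without its
last letter. *)
Definition RS_last m w := (Ptab w, (RS (take m w)).2).

(** The last letter is recovered by undoing its insertion from the first row,
whose last box is a corner in any shape la + 1. *)
Lemma count_last_in_row1 m :
  count (last_in_row1 m) (permutations (iota 1 m.+1)) =
  \sum_(la <- partitions m) nb_SYT (add1 la) * nb_SYT la.
Proof.
set A := [seq w <- permutations (iota 1 m.+1) | last_in_row1 m w].
have AP w : w \in A -> exists w0 x, [/\ w = rcons w0 x, size w0 = m, uniq w,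
    perm_eq w (iota 1 m.+1) & (row_insert (Ptab w0) x).2 = 0].
  rewrite mem_filter mem_permutations => /andP[good pw].
  have szw := perm_size pw; rewrite size_iota in szw.
  have uw : uniq w by rewrite (perm_uniq pw) iota_uniq.
  case/lastP: w good pw szw uw => // w x; rewrite size_rcons => good pw [szw] uw.
  exists w, x; split=> //; apply/eqP; rewrite -row1_rcons.
  by move: good; rewrite /last_in_row1 take_rcons.
rewrite -size_filter -/A -size_SYT_pairs -(size_map (RS_last m)).
apply/perm_size/uniq_perm; last 1 first.
- case=> P Q; apply/mapP/idP.
    case=> w /AP[w0 [x [-> sz uw pw i0]]] [-> ->]; apply/mem_SYT_pairs.
    rewrite take_rcons //; have := uw; rewrite rcons_uniq => /andP[_ u0]; split.
    - by rewrite Ptab_rcons row_insert_shape i0 RS_shape.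
    - exact: Ptab_tableau.
    - exact: RS_Q_tableau.
    - by rewrite (permPl (Ptab_perm _)).
    - by rewrite -sz RS_Q_perm.
  case/mem_SYT_pairs=> shP tP tQ pP pQ.
  have P0 : 0 < size P by rewrite -(size_map size) -/(shape P) shP; case: (shape Q).
  have corner : size (nth [::] P 1) < size (nth [::] P 0).
    rewrite -!nth_shape shP /add1 !nth_incr_nth !nth_shape /= add0n add1n ltnS.
    exact: size_row_nonincr.
  have [T0 [x [insT tT0 xT0]]] := row_insert_surj tP P0 corner.
  have shT0 : shape T0 = shape Q.
    apply: (@shape_incr_inj _ _ 0); [exact: tab_nonnil | exact: tab_nonnil |].
    by have := row_insert_shape T0 x; rewrite insT /= => <-.
  have [w [uw RSw]] := RS_surj tT0 tQ shT0 pQ.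
  have PT : Ptab w = T0 by rewrite -RS_P RSw.
  have sz : size w = m by rewrite -RS_Q_size RSw (perm_size pQ) size_iota.
  have Pwx : Ptab (rcons w x) = P by rewrite Ptab_rcons PT insT.
  exists (rcons w x); last by rewrite /RS_last take_rcons // RSw Pwx.
  rewrite mem_filter /last_in_row1 take_rcons // row1_rcons PT insT eqxx /=.
  by rewrite mem_permutations -(permPl (Ptab_perm _)) Pwx.
- rewrite map_inj_in_uniq; first exact/filter_uniq/permutations_uniq.
  move=> w1 w2 /AP[w [x [-> sz uw _ i0]]] /AP[w' [x' [-> sz' uw' _ i0']]].
  rewrite /RS_last !take_rcons // !Ptab_rcons => -[eP eQ].
  move: uw uw'; rewrite !rcons_uniq => /andP[xw uw] /andP[xw' uw'].
  have [eT ->] : Ptab w = Ptab w' /\ x = x'.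
    apply: row_insert_inj; rewrite ?(perm_mem (Ptab_perm _)) //; try exact: Ptab_tableau.
    by rewrite [LHS]surjective_pairing [RHS]surjective_pairing eP i0 i0'.
  congr rcons; apply: RS_inj => //.
  by rewrite [LHS]surjective_pairing [RHS]surjective_pairing !RS_P eT eQ.
exact: SYT_pairs_uniq.
Qed.

(** This exchanges the first and the last letter and preserves increasing
subsequences. *)
Definition revcomp n (w : seq nat) := rev [seq n.+1 - v | v <- w].

Lemma revcompK n w : all (fun v => v <= n) w -> revcomp n (revcomp n w) = w.
Proof.
move=> wn; rewrite /revcomp map_rev revK -map_comp -[RHS]map_id.
by apply/eq_in_map => v /(allP wn) /= vn; rewrite subKn // leqW.
Qed.

Lemma revcomp_uniq n w : all (fun v => v <= n) w -> uniq w -> uniq (revcomp n w).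
Proof.
move=> wn uw; rewrite rev_uniq map_inj_in_uniq // => a b /(allP wn) an /(allP wn) bn.
by move/(congr1 (subn n.+1)); rewrite !subKn ?leqW.
Qed.

Lemma revcomp_sorted n s : all (fun v => v <= n) s -> sorted ltn s ->
  sorted ltn (revcomp n s).
Proof.
elim: s => // a s IH /= /andP[an sn]; rewrite (path_sortedE ltn_trans) => /andP[sa so].
rewrite /revcomp /= rev_cons sorted_ltn_rcons -/(revcomp n s) IH // andbT.
rewrite all_rev all_map; apply/allP => b bs /=; have := allP sa _ bs; have := allP sn _ bs.
by move=> /=; lia.
Qed.

Lemma row1_revcomp n w : uniq w -> all (fun v => 0 < v <= n) w ->
  row1 (revcomp n w) = row1 w.
Proof.
have le u : uniq u -> all (fun v => 0 < v <= n) u -> row1 u <= row1 (revcomp n u).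
  move=> uu un; have un' : all (fun v => v <= n) u by apply: sub_all un => v /andP[].
  have [s [ss so <-]] := row1_attained uu.
  rewrite -(size_map (fun v => n.+1 - v)) -size_rev; apply: row1_max.
  - exact: revcomp_uniq.
  - by rewrite subseq_rev map_subseq.
  - by apply: revcomp_sorted => //; apply/allP => e /(mem_subseq ss)/(allP un').
move=> uw wn; have wn' : all (fun v => v <= n) w by apply: sub_all wn => v /andP[].
apply/eqP; rewrite eqn_leq le // andbT -{2}(revcompK wn'); apply: le.
  exact: revcomp_uniq.
rewrite all_rev all_map; apply: sub_all wn => v /=; lia.
Qed.

Lemma revcomp_perm n : perm_eq [seq revcomp n w | w <- permutations (iota 1 n)]
  (permutations (iota 1 n)).
Proof.
have pn w : perm_eq w (iota 1 n) -> all (fun v => v <= n) w.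
  by move=> pw; apply/allP => v; rewrite (perm_mem pw) mem_iota; lia.
have prc w : perm_eq w (iota 1 n) -> perm_eq (revcomp n w) (iota 1 n).
  move=> pw; have ur : uniq (revcomp n w).
    by apply: revcomp_uniq; rewrite ?pn // (perm_uniq pw) iota_uniq.
  apply: uniq_perm; rewrite ?iota_uniq //.
  apply: (uniq_min_size ur _ _).2 => [v|]; last first.
    by rewrite size_rev size_map (perm_size pw).
  rewrite mem_rev => /mapP[u]; rewrite (perm_mem pw) !mem_iota => ? ->; lia.
apply: uniq_perm.
- rewrite map_inj_in_uniq ?permutations_uniq // => u v.
  rewrite !mem_permutations => /pn un /pn vn /(congr1 (revcomp n)).
  by rewrite !revcompK.
- exact: permutations_uniq.
move=> w; rewrite mem_permutations; apply/mapP/idP => [[u]|pw].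
  by rewrite mem_permutations => /prc + ->.
by exists (revcomp n w); rewrite ?mem_permutations ?prc ?revcompK ?pn.
Qed.

Lemma word_perm n (pi : 'S_n) : perm_eq (word pi) (iota 1 n).
Proof.
have uw := word_uniq pi; apply: uniq_perm; rewrite ?iota_uniq //.
apply: (uniq_min_size uw _ _).2 => [v|].
  by case/mapP => i _ ->; rewrite mem_iota /= add1n ltnS ltn_ord.
by rewrite size_subword cardsT card_ord size_iota.
Qed.

Lemma word_inj n : injective (@word n).
Proof.
move=> p q /eq_in_map eq; apply/permP => i.
by have := eq i; rewrite mem_enum inE => /(_ isT)[] /val_inj.
Qed.

Lemma words_perm n : perm_eq [seq word pi | pi <- enum {: 'S_n}] (permutations (iota 1 n)).
Proof.
have uw : uniq [seq word pi | pi <- enum {: 'S_n}].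
  by rewrite map_inj_uniq ?enum_uniq //; exact: word_inj.
apply: uniq_perm; rewrite ?permutations_uniq //; apply: (uniq_min_size uw _ _).2.
  by move=> w /mapP[pi _ ->]; rewrite mem_permutations word_perm.
by rewrite size_permutations ?iota_uniq // size_iota size_map -cardE card_Sn.
Qed.

Lemma card_row1_behead m :
  #|[set pi : 'S_m.+1 | row1 (behead (word pi)) < row1 (word pi)]| =
  count (last_in_row1 m) (permutations (iota 1 m.+1)).
Proof.
pose P w := row1 (behead w) < row1 w.
rewrite cardsE cardE /enum_mem size_filter -enumT.
rewrite -(count_map (@word m.+1) P) (seq.permP (words_perm _)) -(seq.permP (revcomp_perm _)).
rewrite count_map; apply: eq_in_count => w; rewrite mem_permutations => pw /=.
have uw : uniq w by rewrite (perm_uniq pw) iota_uniq.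
have wn : all (fun v => 0 < v <= m.+1) w.
  by apply/allP => v; rewrite (perm_mem pw) mem_iota; lia.
have szw := perm_size pw; rewrite size_iota in szw.
case/lastP: w uw wn szw {pw} => // w x; rewrite size_rcons => uwx wxn [szw].
rewrite /P /last_in_row1 take_rcons // row1_revcomp //.
rewrite /revcomp map_rcons rev_rcons [behead _]/= -/(revcomp _ _) row1_revcomp //.
  by move: uwx; rewrite rcons_uniq => /andP[].
by move: wxn; rewrite all_rcons => /andP[].
Qed.

Theorem corollary4p9 (n : nat) (hn : 1 <= n) :
  (forall pi : 'S_n,
     ls [fset 1]%fset pi < lis pi + 1
     <-> last 0 (head [::] (evac (Qtab pi))) = n)
  /\ #|[set pi : 'S_n | ls [fset 1]%fset pi < lis pi + 1]|
     = \sum_(la <- partitions n.-1) nb_SYT (add1 la) * nb_SYT la.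
Proof.
split=> [pi|]; last first.
  rewrite -count_last_in_row1; case: n hn => // m _; rewrite -card_row1_behead.
  by apply: eq_card => pi; rewrite !inE ls1_row1.
rewrite ls1_row1 // /Qtab; have uw := word_uniq pi; have szw := perm_size (word_perm pi).
rewrite size_iota in szw; move: uw szw; case: (word pi) => [|x u] uw szw.
  by rewrite -szw in hn.
have g0 : growth (RS (x :: u)).2 0 n = shape (Ptab (x :: u)).
  by rewrite /= -szw shape_upto_RS // take_size.
have g1 : growth (RS (x :: u)).2 1 n = shape (Ptab u).
  by rewrite -szw growth1_RS // take_size.
rewrite evac_last // ?g0 ?g1 ?nth_shape //.
- by rewrite -size_flatten RS_Q_size.
- rewrite lt0n size_eq0; apply/eqP => sh0.
  have := perm_size (Ptab_perm (x :: u)); rewrite size_flatten sh0 //.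
Qed.
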